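(* Fix $d>0$. For every compact set $S\subset[0,2\pi]$ of positive measure there exists a set $\Lambda\subset\mathbb{Z}$ having uniform density $D(\Lambda)<(1+d)|S|$ such that \[ C(d)\,|S|\,\|f\|_{L^2(\mathbb{R})}^2\le \sum_{\lambda\in\Lambda}|f(\lambda)|^2\qquad\text{for all } f\in PW_S, \] where $C(d)>0$ is a constant depending only on $d$ (and not on $S$).
   Context: $|S|$ denotes the normalized Lebesgue measure on $[0,2\pi]$, i.e. $|S|=\frac{1}{2\pi}\,\mathrm{Leb}(S)$. The Fourier transform is $\hat f(t)=\int_{\mathbb{R}}e^{-ixt}f(x)\,\frac{dx}{2\pi}$. For $S\subset[0,2\pi]$, $PW_S$ is the space of all $f\in L^2(\mathbb{R})$ whose Fourier transform is supported in $S$, with the $L^2(\mathbb{R})$ norm (such $f$ are continuous, so $f(\lambda)$ makes sense). For $\Lambda\subset\mathbb{Z}$ set $D^-(\Lambda)=\lim_{r\to\infty}\frac{\min_{x\in\mathbb{R}}|\Lambda\cap[x,x+r]|}{r}$ and $D^+(\Lambda)=\lim_{r\to\infty}\frac{\max_{x\in\mathbb{R}}|\Lambda\cap[x,x+r]|}{r}$, where $|\cdot|$ of a finite set is its cardinality. $\Lambda$ has uniform density $D(\Lambda)$ if $D^-(\Lambda)=D^+(\Lambda)=:D(\Lambda)$. *)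

(* Defs.v *)
From HB Require Import structures.
From mathcomp Require Import all_boot all_order all_algebra.
From mathcomp Require Import all_classical all_reals all_analysis.
Set Implicit Arguments. Unset Strict Implicit. Unset Printing Implicit Defensive.
Import Order.TTheory GRing.Theory Num.Theory.
Import numFieldNormedType.Exports.
Local Open Scope classical_set_scope.
Local Open Scope ring_scope.

Section Defs.
Variable R : realType.

Definition nmeas (S : set R) : R :=
  fine (@lebesgue_measure R S) / (2 * pi).

(* |Lambda ∩ [x, x+r]| for Lambda ⊂ Z (r >= 0): the integers in [x,x+r]
   are ceil x + k for k = 0, 1, ..., all with k <= trunc r + 1. *)
Definition count_in (L : set int) (x r : R) : nat :=
  (\sum_(k < (Num.truncn r).+2)
     nat_of_bool ((((Num.ceil x + k%:Z)%:~R <= x + r)%R) &&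
                  ((Num.ceil x + k%:Z)%R \in L)))%N.

Definition min_count (L : set int) (r : R) : R :=
  inf [set (count_in L x r)%:R | x in [set: R]].
Definition max_count (L : set int) (r : R) : R :=
  sup [set (count_in L x r)%:R | x in [set: R]].

Definition has_uniform_density (L : set int) (D : R) : Prop :=
  (fun r => min_count L r / r) @ +oo --> D /\
  (fun r => max_count L r / r) @ +oo --> D.

(* Paley-Wiener space PW_S, with f = fr + i fi : R -> C.
   f is in PW_S iff f is the (continuous) inverse Fourier transform of some
   g = a + i b in L^2(S) (g = \hat f extended by 0 outside S):
     f(x) = \int_S g(t) e^{ixt} dt. *)
Definition PW (S : set R) (fr fi : R -> R) : Prop :=
  exists a b : R -> R,
    [/\ measurable_fun S a, measurable_fun S b,
        (\int[@lebesgue_measure R]_(t in S) ((a t) ^+ 2 + (b t) ^+ 2)%:E < +oo)%E,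
        (forall x, fr x = fine (\int[@lebesgue_measure R]_(t in S)
                     (a t * cos (x * t) - b t * sin (x * t))%:E)) &
        (forall x, fi x = fine (\int[@lebesgue_measure R]_(t in S)
                     (a t * sin (x * t) + b t * cos (x * t))%:E))].

Definition L2norm2 (fr fi : R -> R) : \bar R :=
  (\int[@lebesgue_measure R]_(x in [set: R]) ((fr x) ^+ 2 + (fi x) ^+ 2)%:E)%E.

End Defs.

(* Main.v *)
Require Import Defs.
From HB Require Import structures.
From mathcomp Require Import all_boot all_order all_algebra.
From mathcomp Require Import all_classical all_reals all_analysis.
From mathcomp Require Import measurable_realfun.
From mathcomp Require Import complex spectral sesquilinear.
From mathcomp Require Import ring lra.
(* Cut [0, 2pi[ into n cells of length 2pi/n, let K be the m cells that meet S,
   and sample on J + nZ.  Folding t = s + 2 pi j / n and Parseval on one cell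
   turn the sampling inequality into a lower bound for the rows q in J of the
   m columns K of the n x n Fourier matrix.

   Such a J with at most (1 + d) m rows is chosen greedily by the lower barrier
   tr (A - l)^-1 of Batson, Spielman and Srivastava.  No upper barrier is used:
   every row is duplicated N times with N depending on d only, so a row is taken
   at most N times, and by Chebyshev's sum inequality the rows still available
   are almost as good on average as all the rows.

   The Fourier system is the real orthogonal system cos + sin of frequencies in
   Z.  Its completeness in L^2 goes from trigonometric polynomials to intervals
   by composing cos with 1 - (1 - y^k)^(2^k), which converges to the step
   function at 1/2, then to measurable sets by Dynkin's lemma and to L^2
   functions by simple functions.  Only Bessel's inequality on [0, 2pi[ is
   needed to bound the L^2(R) norm: integrate over x in [0, 1[ the sum of
   |f(x + p)|^2 over the integers p. *)

Set Implicit Arguments. Unset Strict Implicit. Unset Printing Implicit Defensive.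
Import Order.TTheory GRing.Theory Num.Theory.
Import numFieldNormedType.Exports.
Local Open Scope classical_set_scope.
Local Open Scope ring_scope.

(** * One barrier step, on eigenvalues *)

(** The obstacle is that samples carry no weights: the barrier method may want the same row again
    and again, whereas a point of the sampling set counts once. Copies cap the multiplicity at N, at
    the price of dividing the constant by N. They also make the stock of rows finite, so the average
    at each step runs over what is left, whose outer products sum to n - A instead of n, where n is
    the size of the stock. After at most a fraction eta of the stock has been used, the mean
    eigenvalue of A is at most eta * n. The weights (lam - l - a)^-2 that the barrier puts on the
    eigenvalues decrease as lam grows, so the weighted mean is no larger than the plain one, and the
    loss is a factor 1 - eta. Thus a, b, eta and N depend on d alone and the final barrier is
    proportional to the number m of cells; m times the cell length is comparable to the measure of
    S, which is where the factor |S| in the theorem comes from. *)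

Section RealStep.
Variables (R : realFieldType) (m : nat).
Implicit Types (x u v w lam : 'I_m -> R).

(** The quadratic in t given by the sum of (u i - t)^2 * v i is nonnegative, and its value at the
    minimum t = B / V is the claim. No square root is taken, so an ordered field is enough. *)
Lemma weighted_cauchy_schwarz u v : (forall i, 0 <= v i) ->
  (\sum_i u i * v i) ^+ 2 <= (\sum_i u i ^+ 2 * v i) * (\sum_i v i).
Proof.
move=> v0; set A := \sum_i u i ^+ 2 * v i; set B := \sum_i u i * v i.
set V := \sum_i v i.
have V0 : 0 <= V by apply: sumr_ge0.
have H t : 0 <= A - (2 * t) * B + t ^+ 2 * V.
  rewrite /A /B /V !mulr_sumr -sumrB -big_split/= sumr_ge0// => i _.
  have -> : u i ^+ 2 * v i - 2 * t * (u i * v i) + t ^+ 2 * v i =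
    (u i - t) ^+ 2 * v i by ring.
  by rewrite mulr_ge0// sqr_ge0.
have [V1|V1] := eqVneq V 0.
  have /eqP/psumr_eq0P vz : V == 0 by rewrite V1.
  have -> : B = 0 by rewrite /B big1// => i _; rewrite vz ?mulr0.
  by rewrite V1 mulr0 expr0n.
have Vp : 0 < V by rewrite lt_def V1.
have := H (B / V).
have -> : A - 2 * (B / V) * B + (B / V) ^+ 2 * V = (A * V - B ^+ 2) / V.
  by field.
by rewrite pmulr_lge0 ?invr_gt0// subr_ge0.
Qed.

(** The double sum of (x i - x j) * (w i - w j) is twice the difference of the two sides, so no
    sorting of the indices is involved. *)
Lemma chebyshev_sum x w : (forall i j, (x i - x j) * (w i - w j) <= 0) ->
  m%:R * (\sum_i x i * w i) <= (\sum_i x i) * (\sum_i w i).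
Proof.
move=> H.
have : \sum_i \sum_j (x i - x j) * (w i - w j) <= 0.
  by apply: sumr_le0 => i _; apply: sumr_le0 => j _.
have -> : \sum_i \sum_j (x i - x j) * (w i - w j) =
    2 * (m%:R * (\sum_i x i * w i)) - 2 * ((\sum_i x i) * (\sum_i w i)).
  transitivity (\sum_i (m%:R * (x i * w i) - x i * (\sum_j w j)
     - w i * (\sum_j x j) + \sum_j x j * w j)).
    apply: eq_bigr => i _.
    have -> : m%:R * (x i * w i) = \sum_(j < m) x i * w i.
      by rewrite sumr_const card_ord mulr_natl.
    rewrite !mulr_sumr -!sumrB -big_split/=; apply: eq_bigr => j _; ring.
  rewrite big_split/= !sumrB -mulr_sumr -!mulr_suml sumr_const card_ord -mulr_natl.
  ring.
lra.
Qed.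

Lemma barrier_real_ineq lam (l a b eta n : R) :
  (0 < m)%N -> 0 < a -> 0 < b -> a * b < 1 -> 0 <= n -> 0 <= eta <= 1 ->
  1 + eta * (b / (1 - a * b)) <= (1 - eta) * (a^-1 - b) ->
  (forall i, 0 <= lam i) -> (forall i, l < lam i) ->
  \sum_i (lam i - l)^-1 <= b -> \sum_i lam i <= eta * n * m%:R ->
  let u i := (lam i - l - a)^-1 in
  let D := \sum_i u i - \sum_i (lam i - l)^-1 in
  [/\ forall i, l + a < lam i, 0 < D &
   D * n <= \sum_i (n - lam i) * u i ^+ 2 - D * \sum_i (n - lam i) * u i].
Proof.
move=> m0 a0 b0 ab n0 /andP[eta0 eta1] hpar lam0 ll hb htr u D.
pose v i := (lam i - l)^-1.
have v0 i : 0 < v i by rewrite invr_gt0 subr_gt0.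
have vb i : v i <= b.
  apply: le_trans hb; rewrite (bigD1 i)//= lerDl; apply: sumr_ge0 => j _; exact: ltW (v0 j).
have av i : a * v i < 1.
  by apply: le_lt_trans ab; rewrite ler_pM2l.
have vne i : lam i - l != 0 by rewrite subr_eq0 gt_eqF.
have la i : l + a < lam i.
  have := av i; rewrite -subr_gt0 /v -(mulfV (vne i)) -mulrBl.
  rewrite pmulr_lgt0 ?v0//; lra.
have u0 i : 0 < u i by rewrite invr_gt0; have := la i; lra.
have une i : lam i - l - a != 0 by apply/eqP => h; have := la i; lra.
have uvE i : u i - v i = a * (u i * v i).
  by rewrite /u /v; field; rewrite une vne.
have DE : D = a * \sum_i u i * v i.
  by rewrite /D -sumrB mulr_sumr; apply: eq_bigr => i _; rewrite -uvE.
have hlam i : lam i = (u i)^-1 + l + a by rewrite /u invrK; ring.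
have [i0] : exists i0 : 'I_m, true by exists (Ordinal m0).
move=> _.
have D0 : 0 < D.
  rewrite DE mulr_gt0// (bigD1 i0)//= ltr_pwDl ?mulr_gt0// sumr_ge0// => j _.
  by rewrite mulr_ge0// ltW.
(* From u = v + a u v the sum of u^2 is D / a plus a times the sum of u^2 v. Cauchy-Schwarz and a *
   sum v <= a * b < 1 bound the latter below by D^2, and D >= sum u - b. *)
have key1 : D * (a^-1 - b + \sum_i u i) <= \sum_i u i ^+ 2.
  have cs := @weighted_cauchy_schwarz u v (fun i => ltW (v0 i)).
  have e1 : \sum_i u i ^+ 2 = \sum_i u i * v i + a * \sum_i u i ^+ 2 * v i.
    rewrite mulr_sumr -big_split/=; apply: eq_bigr => i _.
    have h : u i * u i = u i * (v i + a * (u i * v i)) by rewrite -uvE; ring.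
    rewrite [LHS]expr2 h; ring.
  have V0 : 0 <= \sum_i v i by apply: sumr_ge0 => i _; exact: ltW.
  have uvV : D ^+ 2 <= a * \sum_i u i ^+ 2 * v i.
    rewrite DE exprMn expr2 -mulrA ler_pM2l//.
    apply: (@le_trans _ _ (a * ((\sum_i u i ^+ 2 * v i) * \sum_i v i))).
      by rewrite ler_pM2l.
    have hV : a * \sum_i v i <= 1 by apply: le_trans (ltW ab); rewrite ler_pM2l.
    rewrite mulrCA -[leRHS]mulr1 ler_wpM2l// sumr_ge0// => i _.
    by rewrite mulr_ge0 ?sqr_ge0// ltW.
  have DV : \sum_i u i = D + \sum_i v i by rewrite /D; ring.
  rewrite e1; have -> : \sum_i u i * v i = D * a^-1.
    by rewrite DE mulrAC mulfV ?mul1r// gt_eqF.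
  rewrite DV.
  apply: (@le_trans _ _ (D * a^-1 + D ^+ 2)); last by rewrite lerD2l.
  rewrite expr2 -mulrDr ler_pM2l//; lra.
have key2 : \sum_i u i <= b / (1 - a * b).
  apply: (@le_trans _ _ (\sum_i v i / (1 - a * b))); last first.
    by rewrite -mulr_suml ler_pM2r ?invr_gt0 ?subr_gt0.
  apply: ler_sum => i _; rewrite ler_pdivlMr ?subr_gt0//.
  have : u i = v i + a * (u i * v i) by rewrite -uvE; ring.
  have : a * (u i * v i) <= a * (u i * b) by rewrite !ler_pM2l.
  move=> h1 h2; lra.
(* u is positive and decreasing in [lam], so [lam] and u^2 are oppositely ordered and Chebyshev's
   inequality applies. *)
have key3 : \sum_i lam i * u i ^+ 2 <= eta * n * \sum_i u i ^+ 2.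
  have mR : 0 < m%:R :> R by rewrite ltr0n.
  rewrite -(ler_pM2l mR).
  apply: le_trans (chebyshev_sum _) _.
    move=> i j; rewrite !hlam.
    have -> : (u i)^-1 + l + a - ((u j)^-1 + l + a) = (u j - u i) * (u i * u j)^-1.
      by field; rewrite !gt_eqF.
    have -> : u i ^+ 2 - u j ^+ 2 = - ((u j - u i) * (u i + u j)) by ring.
    rewrite mulrN oppr_le0.
    have -> : (u j - u i) / (u i * u j) * ((u j - u i) * (u i + u j)) =
      (u j - u i) ^+ 2 * ((u i + u j) / (u i * u j)) by field; rewrite !gt_eqF.
    by rewrite mulr_ge0 ?sqr_ge0// divr_ge0 ?addr_ge0 ?mulr_ge0// ltW.
  rewrite mulrCA mulrA ler_wpM2r//.
  apply: sumr_ge0 => i _; exact: sqr_ge0.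
split => //.
have S1 : \sum_i (n - lam i) * u i ^+ 2 >= n * (1 - eta) * \sum_i u i ^+ 2.
  have -> : \sum_i (n - lam i) * u i ^+ 2 = n * \sum_i u i ^+ 2 - \sum_i lam i * u i ^+ 2.
    by rewrite mulr_sumr -sumrB; apply: eq_bigr => i _; ring.
  lra.
have S2 : \sum_i (n - lam i) * u i <= n * \sum_i u i.
  rewrite mulr_sumr; apply: ler_sum => i _; rewrite ler_pM2r// lerBlDr lerDl//.
have S3 : D * \sum_i (n - lam i) * u i <= D * (n * \sum_i u i) by rewrite ler_pM2l.
have S4 : n * (1 - eta) * (D * (a^-1 - b + \sum_i u i)) <=
          n * (1 - eta) * \sum_i u i ^+ 2.
  by rewrite ler_wpM2l// mulr_ge0// subr_ge0.
have S5 : n * D * (1 + eta * \sum_i u i) <= n * D * ((1 - eta) * (a^-1 - b)).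
  rewrite ler_wpM2l ?mulr_ge0//; first exact: ltW.
  apply: le_trans hpar; rewrite lerD2l ler_wpM2l//.
have -> : D * n = n * D * (1 + eta * \sum_i u i) - n * D * eta * \sum_i u i by ring.
lra.
Qed.

End RealStep.

(** [s] stands for 1 + r U c, written as a 1 x 1 matrix identity. *)
Lemma sherman_morrison (F : fieldType) (m : nat) (W U : 'M[F]_m) (c : 'cV[F]_m)
    (r : 'rV[F]_m) (s : F) :
  W *m U = 1%:M -> r *m U *m c = (s - 1)%:M -> s != 0 ->
  (W + c *m r) *m (U - s^-1 *: (U *m c *m r *m U)) = 1%:M.
Proof.
move=> WU rUc s0; rewrite mulmxBr mulmxDl WU -scalemxAr mulmxDl !mulmxA WU mul1mx.
rewrite -(mulmxA c r U) -(mulmxA c (r *m U) c) rUc mul_mx_scalar.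
rewrite -!scalemxAl -!mulmxA -{2}[c *m (r *m U)]scale1r -scalerDl scalerA.
have -> : 1 + (s - 1) = s by ring.
by rewrite mulVf// scale1r addrK.
Qed.

(** * Greedy selection of rank-one terms *)

Section Spectral.
Variables (R : realFieldType) (C : numClosedFieldType).
(* [iota] embeds the reals and [rho] is its inverse on real numbers; stating the
   section for an abstract C keeps the ring structure on C unique, which R[i]
   does not. *)
Variables (iota : {rmorphism R -> C}) (rho : C -> R) (m : nat).
Hypothesis iota_ge0 : forall r, (0 <= iota r) = (0 <= r).
Hypothesis rhoK : forall z, z \is Num.real -> iota (rho z) = z.
Local Open Scope sesquilinear_scope.
Local Notation "x %:C" := (iota x) (at level 1, format "x %:C").
Implicit Types (A P : 'M[C]_m) (f g lam : 'I_m -> R) (v x : 'rV[C]_m).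

(** Functional calculus in the orthonormal eigenbasis formed by the rows of P: inverses and squares
    of A - l become operations on real functions of the index. *)
Definition spec P f : 'M[C]_m := P^t* *m diag_mx (\row_i (f i)%:C) *m P.

Definition nrm2 (z : C) : R := rho (z * z^*).

Lemma nrm2E z : (nrm2 z)%:C = z * z^*.
Proof. by rewrite rhoK// -normCK realE exprn_ge0. Qed.

Lemma nrm2_ge0 z : 0 <= nrm2 z.
Proof. by rewrite -iota_ge0 nrm2E -normCK exprn_ge0. Qed.

Lemma spec_tr P f : P \is unitarymx -> \tr (spec P f) = (\sum_i f i)%:C.
Proof.
move=> /unitarymxP PU; rewrite /spec mxtrace_mulC mulmxA PU mul1mx mxtrace_diag.
by rewrite rmorph_sum; apply: eq_bigr => i _; rewrite mxE.
Qed.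

Lemma spec_mul P f g : P \is unitarymx ->
  spec P f *m spec P g = spec P (fun i => f i * g i).
Proof.
move=> PU; rewrite /spec !mulmxA mulmxtVK// -(mulmxA (P^t* )) mulmx_diag.
congr (_ *m diag_mx _ *m _).
by apply/rowP => i; rewrite !mxE rmorphM.
Qed.

Lemma spec_scalar P (c : R) : P \is unitarymx -> spec P (fun=> c) = (c%:C)%:M.
Proof.
move=> PU; have -> : spec P (fun=> c) = P^t* *m (c%:C)%:M *m P.
  by congr (_ *m _ *m _); rewrite -diag_const_mx; congr diag_mx;
    apply/rowP => i; rewrite !mxE.
rewrite mul_mx_scalar -scalemxAl -invmx_unitary// mulVmx ?unitarymx_unit//.
by rewrite scalemx1.
Qed.

Lemma spec_sub P f g : spec P f - spec P g = spec P (fun i => f i - g i).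
Proof.
rewrite /spec -mulmxBl -mulmxBr -raddfB/=; congr (_ *m diag_mx _ *m _).
by apply/rowP => i; rewrite !mxE rmorphB.
Qed.

Lemma spec_form P f v :
  (v *m spec P f *m v^t* ) 0 0 = (\sum_i f i * nrm2 ((v *m P^t* ) 0 i))%:C.
Proof.
rewrite /spec !mulmxA -mulmxA.
have -> : P *m v^t* = (v *m P^t* )^t* by rewrite trmx_mul map_mxM trmxCK.
rewrite mul_mx_diag mxE rmorph_sum; apply: eq_bigr => i _.
by rewrite !mxE rmorphM nrm2E/=; ring.
Qed.

Lemma hermitian_spec A : A^t* = A ->
  exists P lam, P \is unitarymx /\ A = spec P lam.
Proof.
move=> AH.
have Aherm : A \is hermsymmx.
  by apply/is_hermitianmxP; rewrite expr0 scale1r.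
have /orthomx_spectralP := hermitian_normalmx Aherm.
have /mxOverP lamR := hermitian_spectral_diag_real Aherm.
have PU := spectral_unitarymx A.
set P := spectralmx A in PU *; rewrite invmx_unitary// => AE.
exists P, (fun i => rho (spectral_diag A 0 i)); split => //.
rewrite {1}AE /spec; congr (_ *m diag_mx _ *m _).
by apply/rowP => i; rewrite !mxE rhoK.
Qed.

Lemma outer_form v x : (x *m (v^t* *m v) *m x^t* ) 0 0 = (nrm2 ((x *m v^t* ) 0 0))%:C.
Proof.
rewrite !mulmxA -mulmxA nrm2E.
have -> : v *m x^t* = (x *m v^t* )^t* by rewrite trmx_mul map_mxM trmxCK.
by rewrite mxE big_ord1 !mxE.
Qed.


Lemma dot_spec P x : P \is unitarymx ->
  (x *m x^t* ) 0 0 = (\sum_i nrm2 ((x *m P^t* ) 0 i))%:C.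
Proof.
move=> PU; have := spec_form P (fun=> 1) x; rewrite spec_scalar// rmorph1 mulmx1.
by move=> ->; congr (iota _); apply: eq_bigr => i _; rewrite mul1r.
Qed.

Lemma iota_inj : injective iota.
Proof. exact: fmorph_inj. Qed.

Lemma iota_le r r' : (r%:C <= r'%:C) = (r <= r').
Proof. by rewrite -subr_ge0 -rmorphB iota_ge0 subr_ge0. Qed.

Lemma row_unitary_mul P i : P \is unitarymx -> row i P *m P^t* = row i 1%:M.
Proof. by move=> /unitarymxP PU; rewrite -row_mul PU. Qed.

Lemma spec_eigen P lam i : P \is unitarymx ->
  (row i P *m spec P lam *m (row i P)^t* ) 0 0 = (lam i)%:C.
Proof.
move=> PU; rewrite spec_form row_unitary_mul//; congr (iota _).
rewrite (bigD1 i)//= big1 => [|j ji]; last first.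
  rewrite /nrm2 !mxE [i == j]eq_sym (negbTE ji) mul0r.
  have -> : rho 0 = 0 by apply: iota_inj; rewrite rhoK ?real0// rmorph0.
  by rewrite mulr0.
have -> : nrm2 ((row i 1%:M : 'rV[C]_m) 0 i) = 1.
  by apply: iota_inj; rewrite nrm2E !mxE eqxx rmorph1 mul1r conjC1.
by rewrite mulr1 addr0.
Qed.

(** The sum is tr (A - l)^-1. The diagonalisation is part of the statement so that each step can
    work on real eigenvalues. *)
Definition barrier A (l b : R) := exists P lam,
  [/\ P \is unitarymx, A = spec P lam, forall i, l < lam i &
      \sum_i (lam i - l)^-1 <= b].

Lemma barrier_update P lam (l D : R) v :
  P \is unitarymx -> (spec P lam)^t* = spec P lam -> (forall i, l < lam i) ->
  let u i := (lam i - l)^-1 in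
  let w i := nrm2 ((v *m P^t* ) 0 i) in
  D * (1 + \sum_i u i * w i) <= \sum_i u i ^+ 2 * w i ->
  barrier (spec P lam + v^t* *m v) l (\sum_i u i - D).
Proof.
move=> PU AH ll u w hD.
have vH : (v^t* *m v)^t* = v^t* *m v by rewrite trmx_mul map_mxM trmxCK.
have [P' [lam' [PU' AE]]] : exists P' lam', P' \is unitarymx /\
    spec P lam + v^t* *m v = spec P' lam'.
  by apply: hermitian_spec; rewrite linearD map_mxD/= AH vH.
have u0 i : 0 < u i by rewrite invr_gt0 subr_gt0.
have w0 i : 0 <= w i by exact: nrm2_ge0.
(* An eigenvector x of the new matrix with eigenvalue at most l would satisfy x (A - l) x^* + |x
   v^*|^2 <= 0, which forces x = 0 since A - l is positive definite. *)
have l'l i : l < lam' i.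
  rewrite ltNge; apply/negP => hle.
  have h : (\sum_j (lam j - l) * nrm2 ((row i P' *m P^t* ) 0 j) +
     nrm2 ((row i P' *m v^t* ) 0 0)) = lam' i - l.
    apply: iota_inj; rewrite rmorphD -spec_form -outer_form.
    have -> : spec P (fun j => lam j - l) = spec P lam - (l%:C)%:M.
      by rewrite -(spec_scalar l PU) spec_sub.
    have -> : (lam' i - l)%:C = (row i P' *m spec P' (fun j => lam' j - l) *m
       (row i P')^t* ) 0 0 by rewrite spec_eigen.
    have -> : spec P' (fun j => lam' j - l) = spec P lam - (l%:C)%:M + v^t* *m v.
      by rewrite -spec_sub spec_scalar// -AE addrAC.
    by rewrite [in RHS]mulmxDr [in RHS]mulmxDl [in RHS]mxE.
  have s0 : \sum_j (lam j - l) * nrm2 ((row i P' *m P^t* ) 0 j) = 0.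
    apply/eqP; rewrite eq_le; apply/andP; split.
      have := nrm2_ge0 ((row i P' *m v^t* ) 0 0); lra.
    by apply: sumr_ge0 => j _; rewrite mulr_ge0 ?nrm2_ge0// subr_ge0 ltW.
  have z j : nrm2 ((row i P' *m P^t* ) 0 j) = 0.
    have /psumr_eq0P : forall j, true ->
      0 <= (lam j - l) * nrm2 ((row i P' *m P^t* ) 0 j).
      by move=> k _; rewrite mulr_ge0 ?nrm2_ge0// subr_ge0 ltW.
    move=> /(_ s0 j isT) /eqP; rewrite mulf_eq0 subr_eq0 gt_eqF//=.
    by move=> /eqP.
  have := dot_spec (row i P') PU; rewrite big1// rmorph0.
  have := dot_spec (row i P') PU'; have := spec_eigen (fun=> 1) i PU'.
  rewrite spec_scalar// rmorph1 mulmx1 => -> _ /eqP.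
  by rewrite oner_eq0.
exists P', lam'; split => //.
pose q := \sum_i u i ^+ 2 * w i; pose s := 1 + \sum_i u i * w i.
have s1 : 0 < s by rewrite ltr_pwDl// sumr_ge0// => i _; rewrite mulr_ge0// ltW.
pose U := spec P u; pose W := spec P (fun i => lam i - l).
pose U' := spec P' (fun i => (lam' i - l)^-1).
pose W' := spec P' (fun i => lam' i - l).
have mulspecV P0 lam0 : P0 \is unitarymx -> (forall i, l < lam0 i) ->
   spec P0 (fun i => lam0 i - l) *m spec P0 (fun i => (lam0 i - l)^-1) = 1%:M.
  move=> PU0 l0; rewrite spec_mul//.
  rewrite -[1%:M]/((1 : C)%:M) -(rmorph1 iota) -(spec_scalar _ PU0).
  rewrite /spec; congr (_ *m diag_mx _ *m _).
  by apply/rowP => i; rewrite !mxE mulfV// subr_eq0 gt_eqF.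
have WU : W *m U = 1%:M by exact: mulspecV.
have WU' : W' *m U' = 1%:M by exact: mulspecV.
have W'E : W' = W + v^t* *m v.
  rewrite /W' /W -!spec_sub !spec_scalar// -AE addrAC//.
have vUv : v *m U *m v^t* = ((s - 1)%:C)%:M.
  rewrite [LHS]mx11_scalar /U spec_form; congr (_%:M); congr (iota _).
  rewrite /s addrAC subrr add0r//.
pose X := U - (s^-1)%:C *: (U *m v^t* *m v *m U).
have W'X : W' *m X = 1%:M.
  rewrite W'E /X fmorphV; apply: sherman_morrison => //.
    by rewrite vUv rmorphB rmorph1.
  by rewrite fmorph_eq0 gt_eqF.
(* Both are inverses of W', one from Sherman-Morrison and one from the new eigenvalues, so their
   traces agree. *)
have XU' : X = U'.
  have /mulmx1C U'W' := WU'.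
  by rewrite -[X]mul1mx -U'W' -mulmxA W'X mulmx1.
have := congr1 mxtrace XU'.
rewrite /X /U' linearB/= linearZ/= !spec_tr//.
have -> : \tr (U *m v^t* *m v *m U) = q%:C.
  rewrite -[U *m v^t* *m v *m U]mulmxA mxtrace_mulC mulmxA.
  rewrite -(mulmxA v U U) /U spec_mul//.
  rewrite [X in \tr X]mx11_scalar mxtrace_scalar mulr1n spec_form.
  by congr (iota _); apply: eq_bigr => i _; rewrite expr2.
rewrite -rmorphM -rmorphB => /iota_inj <-.
rewrite lerD2l lerN2 mulrC ler_pdivlMr//.
Qed.


(** Averaging a quadratic form over rows thus needs nothing but the sum of their outer products. *)
Lemma tr_outer_form (I : finType) (T : pred I) (e : I -> 'rV[C]_m) A :
  \sum_(i in T) (e i *m A *m (e i)^t* ) 0 0 =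
  \tr (A *m \sum_(i in T) (e i)^t* *m e i).
Proof.
rewrite mulmx_sumr linear_sum/=; apply: eq_bigr => i _.
rewrite mulmxA mxtrace_mulC mulmxA [X in \tr X]mx11_scalar.
by rewrite mxtrace_scalar mulr1n.
Qed.

(** The potential stays at most b while every row taken raises the barrier by a. The trace of A is k
    * m, so the bound on k is the trace hypothesis of [barrier_real_ineq]. *)
Lemma barrier_greedy (I : finType) (e : I -> 'rV[C]_m) (a b eta : R) (k : nat) :
  (0 < m)%N -> 0 < a -> 0 < b -> a * b < 1 -> 0 <= eta <= 1 ->
  1 + eta * (b / (1 - a * b)) <= (1 - eta) * (a^-1 - b) ->
  (forall i, (e i *m (e i)^t* ) 0 0 = m%:R) ->
  \sum_i (e i)^t* *m e i = (#|I|%:R)%:M ->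
  k%:R <= eta * #|I|%:R ->
  exists T : {set I}, #|T| = k /\
    barrier (\sum_(i in T) (e i)^t* *m e i) (- (m%:R / b) + k%:R * a) b.
Proof.
move=> m0 a0 b0 ab eta01 hpar enorm etight; elim: k => [|k IH] hk.
  (* For A = 0 and l = - m / b the potential is m * (b / m), exactly b. *)
  exists finset.set0; rewrite cards0 big_set0; split=> //.
  have u1 : (1%:M : 'M[C]_m) \is unitarymx by apply/unitarymxP; rewrite trmx1 map_mx1 mulmx1.
  exists 1%:M, (fun=> 0); split => //.
  - by rewrite spec_scalar// rmorph0 raddf0.
  - by move=> i; rewrite mul0r addr0 oppr_lt0 divr_gt0// ltr0n.
  - rewrite sumr_const card_ord mul0r addr0 sub0r opprK invf_div.
    have -> : b / m%:R *+ m = m%:R * (b / m%:R) by rewrite mulr_natl.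
    by rewrite mulrCA mulfV ?mulr1// pnatr_eq0 -lt0n.
have kk : k%:R <= k.+1%:R :> R by rewrite ler_nat.
have [T [Tk [P [lam [PU AE ll lb]]]]] := IH (le_trans kk hk).
set A := \sum_(i in T) _ in AE.
have AH : (spec P lam)^t* = spec P lam.
  rewrite -AE /A raddf_sum map_mx_sum/=; apply: eq_bigr => i _.
  by rewrite trmx_mul map_mxM trmxCK.
have lam0 i : 0 <= lam i.
  rewrite -iota_ge0 -(spec_eigen lam i PU) -AE /A mulmx_sumr mulmx_suml summxE.
  by apply: sumr_ge0 => j _; rewrite outer_form iota_ge0 nrm2_ge0.
have trA : \sum_i lam i = k%:R * m%:R.
  apply: iota_inj; rewrite -(spec_tr lam PU) -AE -[A]mul1mx -tr_outer_form.
  under eq_bigr do rewrite mulmx1 enorm.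
  by rewrite sumr_const Tk -mulrnA mulnC rmorphM !rmorph_nat natrM mulrC.
have htr : \sum_i lam i <= eta * #|I|%:R * m%:R.
  by rewrite trA ler_wpM2r// (le_trans kk).
set l := - (m%:R / b) + k%:R * a in ll lb *.
pose u i := (lam i - l - a)^-1.
pose D := \sum_i u i - \sum_i (lam i - l)^-1.
have [la D0 key] : [/\ forall i, l + a < lam i, 0 < D &
   D * #|I|%:R <= \sum_i (#|I|%:R - lam i) * u i ^+ 2 -
                  D * \sum_i (#|I|%:R - lam i) * u i].
  exact: (barrier_real_ineq m0 a0 b0 ab (ler0n _ _) eta01 hpar lam0 ll lb htr).
have kI : (k < #|I|)%N.
  rewrite -(ler_nat R); apply: (le_trans hk).
  by rewrite -[leRHS]mul1r ler_wpM2r//; case/andP: eta01.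
have compl : \sum_(i in ~: T) (e i)^t* *m e i = spec P (fun i => #|I|%:R - lam i).
  rewrite -spec_sub spec_scalar// rmorph_nat -AE -etight /A.
  rewrite [X in _ = X - _](bigID (mem T))/= addrAC subrr add0r.
  by apply: eq_bigl => i; rewrite inE.
have avg (g : 'I_m -> R) : \sum_(i in ~: T) \sum_j g j * nrm2 ((e i *m P^t* ) 0 j) =
   \sum_j (#|I|%:R - lam j) * g j.
  apply: iota_inj; rewrite rmorph_sum; under eq_bigr do rewrite -spec_form.
  rewrite tr_outer_form compl spec_mul// spec_tr//.
  by congr (iota _); apply: eq_bigr => j _; rewrite mulrC.
pose w i j := nrm2 ((e i *m P^t* ) 0 j).
have [i iT hi] : exists2 i, i \notin T &
    D * (1 + \sum_j u j * w i j) <= \sum_j u j ^+ 2 * w i j.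
  have [/existsP[i /andP[iT hi]]|/existsPn H] := boolP [exists i, (i \notin T) &&
    (D * (1 + \sum_j u j * w i j) <= \sum_j u j ^+ 2 * w i j)].
    by exists i.
  exfalso.
  have cT : (0 < #|~: T|)%N by rewrite cardsCs finset.setCK Tk subn_gt0.
  have h1 : \sum_(i in ~: T) (\sum_j u j ^+ 2 * w i j) <
            \sum_(i in ~: T) (D * (1 + \sum_j u j * w i j)).
    have [i0 i0T] : exists i0, i0 \in ~: T by apply/card_gt0P.
    apply: ltr_sum => [|i]; last first.
      rewrite inE => iT; have := H i; rewrite iT/= -ltNge//.
    by apply/hasP; exists i0 => //; rewrite mem_index_enum.
  move: h1; rewrite avg -mulr_sumr big_split/= avg sumr_const mulrDr.
  apply/negP; rewrite -leNgt.
  apply: (@le_trans _ _ (D * #|I|%:R + D * \sum_j (#|I|%:R - lam j) * u j)).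
    by rewrite lerD2r ler_pM2l// ler_nat max_card.
  lra.
exists (i |: T); rewrite cardsU1 iT Tk; split=> //.
rewrite big_setU1//= -/A AE addrC.
have -> : - (m%:R / b) + k.+1%:R * a = l + a by rewrite -natr1 /l; ring.
have uE j : (lam j - (l + a))^-1 = u j by rewrite /u opprD addrA.
have [] := @barrier_update P lam (l + a) D (e i) PU AH la.
  under eq_bigr do rewrite uE.
  by under [leRHS]eq_bigr do rewrite uE.
move=> P' [lam' [PU' E' l' b']].
exists P', lam'; split=> //; apply: (le_trans b'); apply: le_trans lb.
rewrite (eq_bigr u) => [|j _]; last exact: uE.
by rewrite /D opprB addrCA subrr addr0.
Qed.


Lemma barrier_form A l b x : barrier A l b ->
  (l * \sum_i nrm2 (x 0 i))%:C <= (x *m A *m x^t* ) 0 0.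
Proof.
move=> [P [lam [PU -> ll _]]]; rewrite spec_form iota_le.
have -> : \sum_i nrm2 (x 0 i) = \sum_i nrm2 ((x *m P^t* ) 0 i).
  apply: iota_inj; rewrite -dot_spec// mxE rmorph_sum.
  by apply: eq_bigr => i _; rewrite nrm2E !mxE.
by rewrite mulr_sumr; apply: ler_sum => i _; rewrite ler_wpM2r ?nrm2_ge0// ltW.
Qed.

End Spectral.

(** * Rows of the Fourier matrix *)

Section FourierRows.
Variable R : realType.
Local Open Scope complex_scope.
Local Open Scope sesquilinear_scope.
Local Notation C := R[i].

Definition cis (t : R) : C := cos t +i* sin t.

Lemma cisD s t : cis (s + t) = cis s * cis t.
Proof. by rewrite /cis cosD sinD; simpc; rewrite addrC [in X in _ +i* X]addrC. Qed.

Lemma cis_conj t : (cis t)^*%R = cis (- t).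
Proof. by rewrite /cis cosN sinN. Qed.

Lemma cis_natmul k t : cis (k%:R * t) = cis t ^+ k.
Proof.
elim: k => [|k IH]; first by rewrite mul0r /cis cos0 sin0 expr0.
by rewrite exprS -IH -cisD -natr1 mulrDl mul1r addrC.
Qed.

Lemma cis_sum_root (n : nat) (t : R) : (0 < n)%N -> cis t != 1 ->
  cis (n%:R * t) = 1 -> \sum_(q < n) cis (q%:R * t) = 0.
Proof.
move=> n0 t1; rewrite cis_natmul => tn.
under eq_bigr do rewrite cis_natmul.
have /eqP := subrX1 (cis t) n; rewrite tn subrr eq_sym mulf_eq0 subr_eq0.
by rewrite (negbTE t1)/= => /eqP.
Qed.


(** cos t = 1 forces sin (|t| / 2) = 0, but for nonzero t the half angle lies strictly between 0 and
    pi. *)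
Lemma cos_eq1_lt2pi (t : R) : `|t| < 2 * pi -> cos t = 1 -> t = 0.
Proof.
move=> t2 c1; apply/eqP/negPn/negP => t0.
have : 0 < sin (`|t| / 2).
  by apply: sin_gt0_pi; rewrite divr_gt0 ?normr_gt0//=; lra.
have : sin (`|t| / 2) ^+ 2 = 0.
  have : cos (`|t|) = 1.
    by have [_|_] := ger0P t => //; rewrite cosN.
  have -> : `|t| = (`|t| / 2) *+ 2 by rewrite -mulr_natr divfK// pnatr_eq0.
  rewrite cos_mulr2n cos2sin2 -mulr_natr => h; rewrite -[`|t| / 2 *+ 2]mulr_natr divfK ?pnatr_eq0//.
  lra.
by move=> /eqP; rewrite expf_eq0/= => /eqP ->; rewrite ltxx.
Qed.

Lemma cis_neq1 t : t != 0 -> `|t| < 2 * pi -> cis t != 1.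
Proof.
by move=> t0 t2; apply/eqP => -[c1 _]; move: t0; rewrite (cos_eq1_lt2pi t2 c1) eqxx.
Qed.

Lemma cis_2pi k : cis (k%:R * (2 * pi)) = 1.
Proof.
by rewrite cis_natmul /cis mulr_natl cos2pi sin2pi expr1n.
Qed.

Lemma cis_rows_orthogonal (n : nat) (j j' : 'I_n) :
  \sum_(q < n) cis (q%:R * (j%:R * (2 * pi / n%:R))) *
               cis (- (q%:R * (j'%:R * (2 * pi / n%:R)))) = (n * (j == j'))%:R.
Proof.
have n0 : (0 < n)%N by exact: leq_ltn_trans (ltn_ord j).
have nR : n%:R != 0 :> R by rewrite pnatr_eq0 -lt0n.
pose t : R := (j%:R - j'%:R) * (2 * pi / n%:R).
transitivity (\sum_(q < n) cis (q%:R * t)).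
  by apply: eq_bigr => q _; rewrite -cisD; congr cis; rewrite /t; ring.
have [jj'|jj'] := eqVneq j j'.
  rewrite muln1 (eq_bigr (fun=> 1)) ?sumr_const ?card_ord// => q _.
  by rewrite /t jj' subrr mul0r mulr0 /cis cos0 sin0.
rewrite muln0 cis_sum_root//.
- have p2 : 0 < 2 * pi :> R by rewrite mulr_gt0// pi_gt0.
  have jn : `|j%:R - j'%:R| < n%:R :> R.
    have := ltn_ord j; have := ltn_ord j'; rewrite -!(ltr_nat R) ltr_norml.
    have : 0 <= j%:R :> R by []. have : 0 <= j'%:R :> R by [].
    by move=> *; apply/andP; split; lra.
  apply: cis_neq1.
    rewrite mulf_neq0// ?subr_eq0 ?eqr_nat//.
    by rewrite mulf_neq0// ?invr_eq0// gt_eqF.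
  rewrite normrM (ger0_norm (x := 2 * pi / n%:R)) ?divr_ge0 ?(ltW p2)//.
  by rewrite mulrCA gtr_pMr// ltr_pdivrMr ?ltr0n// mul1r.
- rewrite /t mulrCA [n%:R * _]mulrC divfK//.
  by rewrite mulrBl cisD cis_2pi -cis_conj cis_2pi conjC1 mulr1.
Qed.

Lemma nrm2_complex (z : C) :
  nrm2 (@complex.Re R) z = complex.Re z ^+ 2 + complex.Im z ^+ 2.
Proof.
by apply: (@complexI R); rewrite add_Re2_Im2 nrm2E ?normCK// => x; exact: RRe_real.
Qed.

(** The upper bound on k is what keeps the number of copies independent of n and K. J may have fewer
    than k elements because copies of one row are merged. *)
Lemma fourier_rows_selection (d : R) : 0 < d -> exists c : R, 0 < c /\
  forall (n : nat) (K : {set 'I_n}) (k : nat), (0 < #|K|)%N ->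
  (1 + d) * #|K|%:R <= k%:R <= 2 * (1 + d) * #|K|%:R ->
  exists J : {set 'I_n}, (#|J| <= k)%N /\
  forall x y : 'I_n -> R, (forall j, j \notin K -> x j = 0 /\ y j = 0) ->
  let t (q j : 'I_n) := q%:R * (j%:R * (2 * pi / n%:R)) : R in
  c * #|K|%:R * \sum_j (x j ^+ 2 + y j ^+ 2) <=
  \sum_(q in J) ((\sum_j (x j * cos (t q j) - y j * sin (t q j))) ^+ 2 +
                 (\sum_j (x j * sin (t q j) + y j * cos (t q j))) ^+ 2).
Proof.
move=> d0.
(* The gap 1 / a - b = 3 / 2 lies strictly between 1, so that [hpar] can hold with some eta > 0, and
   d * b = 2, so that c below is positive. *)
pose b : R := 2 / d; pose a : R := (b + 3 / 2)^-1.
have b0 : 0 < b by rewrite divr_gt0.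
have a0 : 0 < a by rewrite invr_gt0; lra.
have aE : a^-1 = b + 3 / 2 by rewrite invrK.
pose B := b / (1 - a * b).
have BE : B = 2 / 3 * (b * (b + 3 / 2)).
  by rewrite /B /a; field; apply/andP; split; apply/eqP; lra.
have B0 : 0 < B by rewrite BE mulr_gt0// mulr_gt0//; lra.
(* Chosen to make [hpar] an equality: 1 + eta * B = 3 / 2 * (1 - eta). *)
pose eta : R := (2 * (3 / 2 + B))^-1.
have eta0 : 0 < eta by rewrite invr_gt0; lra.
have etaE : eta * (3 / 2 + B) = 1 / 2.
  by rewrite /eta; field; apply/eqP; lra.
have eta1 : eta <= 1.
  have : 0 < eta * B by rewrite mulr_gt0.
  lra.
have ab1 : a * b < 1 by rewrite /a mulrC ltr_pdivrMr ?mul1r; lra.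
have hpar : 1 + eta * B <= (1 - eta) * (a^-1 - b) by rewrite aE; lra.
(* Enough copies for k <= 2 * (1 + d) * n to be at most the fraction eta of the n * N rows. *)
pose N := (Num.truncn (2 * (1 + d) / eta)).+1.
have hN : 2 * (1 + d) <= eta * N%:R.
  rewrite [leRHS]mulrC -ler_pdivrMr//.
  by apply: ltW; exact: truncnS_gt.
have N0 : 0 < N%:R :> R by rewrite ltr0n.
(* For k >= (1 + d) * m the final barrier - m / b + k * a is at least c * m. *)
pose c := (1 + d) * a - b^-1.
have c0 : 0 < c.
  have -> : c = d ^+ 2 / (2 * (4 + 3 * d)).
    rewrite /c /a /b; field.
    by rewrite !gt_eqF//; lra.
  by rewrite divr_gt0 ?exprn_gt0//; lra.
exists (c / N%:R); split; first by rewrite divr_gt0.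
move=> n K k m0 /andP[k1 k2].
pose m := #|K|.
pose t (q j : 'I_n) : R := q%:R * (j%:R * (2 * pi / n%:R)).
have iota_ge0 (r : R) : (0 <= r%:C) = (0 <= r) by rewrite ler0c.
have rhoK (z : C) : z \is Num.real -> (complex.Re z)%:C = z by exact: RRe_real.
(* The minus sign is undone by the conjugation in z e^*, which becomes the sum of z_j e^{i t}. *)
pose e (p : 'I_n * 'I_N) : 'rV[C]_m := \row_i cis (- t p.1 (enum_val i)).
have enorm p : (e p *m (e p)^t* ) 0 0 = m%:R.
  rewrite mxE (eq_bigr (fun=> 1)) ?sumr_const ?card_ord// => i _.
  by rewrite !mxE cis_conj -cisD subrr /cis cos0 sin0.
have cardI : #|{: 'I_n * 'I_N}| = (n * N)%N by rewrite card_prod !card_ord.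
have etight : \sum_p (e p)^t* *m e p = (#|{: 'I_n * 'I_N}|%:R)%:M.
  apply/matrixP => i i'; rewrite summxE cardI.
  transitivity (\sum_(q < n) \sum_(r < N) cis (t q (enum_val i)) * cis (- t q (enum_val i'))).
    rewrite pair_bigA/=; apply: eq_bigr => p _.
    by rewrite mxE big_ord1 !mxE cis_conj opprK.
  under eq_bigr do rewrite sumr_const card_ord.
  rewrite sumrMnl cis_rows_orthogonal !mxE (inj_eq enum_val_inj).
  by case: (i == i'); rewrite ?muln1 ?muln0 ?mulr1n ?mulr0n ?mul0rn// -mulrnA.
have hk : k%:R <= eta * #|{: 'I_n * 'I_N}|%:R.
  apply: (le_trans k2); rewrite cardI natrM [n%:R * _]mulrC mulrA.
  apply: (@le_trans _ _ (2 * (1 + d) * n%:R)).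
    by rewrite ler_pM2l ?ler_nat; [rewrite -[leqRHS]card_ord; exact: max_card|lra].
  by rewrite ler_wpM2r.
have eta01 : 0 <= eta <= 1 by rewrite (ltW eta0).
have [T [Tk bar]] := @barrier_greedy R C (real_complex R) (@complex.Re R) m
  iota_ge0 rhoK _ e a b eta k m0 a0 b0 ab1 eta01 hpar enorm etight hk.
pose J : {set 'I_n} := (fst @: T)%SET.
exists J; split; first by rewrite -Tk leq_imset_card.
move=> x y xyK /=; rewrite -/t.
pose z : 'rV[C]_m := \row_i (x (enum_val i) +i* y (enum_val i)).
have := barrier_form iota_ge0 rhoK z bar.
rewrite mulmx_sumr mulmx_suml summxE.
under [leRHS]eq_bigr do rewrite (outer_form rhoK).
rewrite -rmorph_sum lecR => H.
pose F (q : 'I_n) := (\sum_j (x j * cos (t q j) - y j * sin (t q j))) ^+ 2 +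
                 (\sum_j (x j * sin (t q j) + y j * cos (t q j))) ^+ 2.
have F0 q : 0 <= F q by rewrite addr_ge0 ?sqr_ge0.
have toK (G : 'I_n -> R) : (forall j, j \notin K -> G j = 0) ->
    \sum_j G j = \sum_(i < m) G (enum_val i).
  move=> G0; rewrite (bigID (mem K))/= [X in _ + X]big1 ?addr0//.
  by rewrite [LHS]big_enum_val.
have FE p : nrm2 (@complex.Re R) ((z *m (e p)^t* ) 0 0) = F p.1.
  rewrite nrm2_complex mxE /F.
  rewrite toK => [|j /xyK[-> ->]]; last by rewrite !mul0r subrr.
  rewrite toK => [|j /xyK[-> ->]]; last by rewrite !mul0r addr0.
  pose g (i : 'I_m) : 'I_n := @enum_val _ (mem K) i.
  have -> : \sum_j z 0 j * (e p)^t* j 0 =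
      \sum_j ((x (g j) * cos (t p.1 (g j)) - y (g j) * sin (t p.1 (g j))) +i*
              (x (g j) * sin (t p.1 (g j)) + y (g j) * cos (t p.1 (g j)))).
    by apply: eq_bigr => j _; rewrite !mxE cis_conj opprK /cis; simpc.
  congr (_ ^+ 2 + _ ^+ 2).
    by elim/big_rec2: _ => //= i u [v1 v2] _ /= <-.
  by elim/big_rec2: _ => //= i u [v1 v2] _ /= <-.
have E1 : \sum_j (x j ^+ 2 + y j ^+ 2) = \sum_i nrm2 (@complex.Re R) (z 0 i).
  rewrite toK => [|j /xyK[-> ->]]; last by rewrite expr0n addr0.
  by apply: eq_bigr => i _; rewrite nrm2_complex mxE.
(* A row of J has at most N copies in T. *)
have E2 : \sum_(p in T) F p.1 <= N%:R * \sum_(q in J) F q.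
  rewrite mulr_sumr.
  have -> : \sum_(q in J) N%:R * F q = \sum_(q in J) \sum_(r < N) F q.
    by apply: eq_bigr => q _; rewrite sumr_const card_ord mulr_natl.
  rewrite pair_big_dep/= [leRHS](bigID (mem T))/=.
  rewrite -[leLHS]addr0 lerD//; last by apply: sumr_ge0.
  rewrite le_eqVlt; apply/orP; left; apply/eqP; apply: eq_bigl => p; rewrite andbT.
  by case: (boolP (p \in T)) => pT; rewrite ?andbF ?andbT//; apply/esym/imsetP; exists p.
rewrite E1.
have s0 : 0 <= \sum_i nrm2 (@complex.Re R) (z 0 i).
  by apply: sumr_ge0 => i _; exact: (nrm2_ge0 iota_ge0 rhoK).
set s := \sum_i _ in s0 *.
have -> : c / N%:R * #|K|%:R * s = m%:R * c * s / N%:R by rewrite /m; ring.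
rewrite ler_pdivrMr// [leRHS]mulrC.
apply: le_trans E2; under eq_bigr do rewrite -FE.
apply: le_trans H; rewrite ler_wpM2r//.
have : (1 + d) * m%:R * a <= k%:R * a by rewrite ler_pM2r.
by rewrite /c; lra.
Qed.

End FourierRows.

(** * Square-integrable functions and Bessel's inequality *)

Section L2.
Context (dsp : measure_display) (X : measurableType dsp) (R : realType).
Variables (mu : {measure set X -> \bar R}) (D : set X).
Hypothesis mD : measurable D.
Implicit Types f g h : X -> R.

Definition sqint f := measurable_fun D f /\
  mu.-integrable D (EFin \o (fun x => f x ^+ 2)).

Definition ip f g : R := \int[mu]_(x in D) (f x * g x).

Lemma sqint_mul f g : sqint f -> sqint g ->
  mu.-integrable D (EFin \o (fun x => f x * g x)).
Proof.
move=> [mf f2] [mg g2].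
apply: (@le_integrable _ _ _ mu D mD _ (EFin \o (fun x => f x ^+ 2 + g x ^+ 2))).
- by apply/measurable_EFinP; exact: measurable_funM.
- move=> x Dx /=; rewrite lee_fin normrM [leRHS]ger0_norm ?addr_ge0 ?sqr_ge0//.
  rewrite -(real_normK (num_real (f x))) -(real_normK (num_real (g x))).
  have := sqr_ge0 (`|f x| - `|g x|); rewrite sqrrB.
  have := mulr_ge0 (normr_ge0 (f x)) (normr_ge0 (g x)); lra.
- by have := integrableD mD f2 g2; apply: eq_integrable => // x xD /=; rewrite -EFinD.
Qed.

Lemma sqintD f g : sqint f -> sqint g -> sqint (fun x => f x + g x).
Proof.
move=> sf sg; split; first by case: sf sg => ? _ [? _]; exact: measurable_funD.
have := integrableD mD (integrableD mD sf.2 (sqint_mul sf sg))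
                       (integrableD mD sg.2 (sqint_mul sf sg)).
by apply: eq_integrable => // x xD /=; rewrite -!EFinD; congr EFin; ring.
Qed.

Lemma sqintZ k f : sqint f -> sqint (fun x => k * f x).
Proof.
move=> [mf f2]; split; first exact: measurable_funM.
have := integrableZl mD (k ^+ 2) f2.
by apply: eq_integrable => // x xD /=; rewrite -EFinM; congr EFin; ring.
Qed.

Lemma sqintB f g : sqint f -> sqint g -> sqint (fun x => f x - g x).
Proof.
move=> sf sg; have := sqintD sf (sqintZ (-1) sg).
by under eq_fun do rewrite mulN1r.
Qed.

Lemma sqint0 : sqint (fun=> 0).
Proof.
split => //; have := integrable0 mu D.
by apply: eq_integrable => // x xD /=; rewrite expr0n.
Qed.

Lemma sqint_sum (I : Type) (r : seq I) (f : I -> X -> R) :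
  (forall i, sqint (f i)) -> sqint (fun x => \sum_(i <- r) f i x).
Proof.
move=> sf; elim: r => [|i r IH].
  by under eq_fun do rewrite big_nil; exact: sqint0.
by under eq_fun do rewrite big_cons; exact: sqintD.
Qed.

Lemma ipC f g : ip f g = ip g f.
Proof. by rewrite /ip; under eq_Rintegral do rewrite mulrC. Qed.

Lemma ipDl f g h : sqint f -> sqint g -> sqint h ->
  ip (fun x => f x + g x) h = ip f h + ip g h.
Proof.
move=> sf sg sh; rewrite /ip -RintegralD//; [|exact: sqint_mul..].
by apply: eq_Rintegral => x _; rewrite mulrDl.
Qed.

Lemma ipZl k f h : sqint f -> sqint h -> ip (fun x => k * f x) h = k * ip f h.
Proof.
move=> sf sh; rewrite /ip -RintegralZl//; last exact: sqint_mul.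
by apply: eq_Rintegral => x _; rewrite mulrA.
Qed.

Lemma ipBl f g h : sqint f -> sqint g -> sqint h ->
  ip (fun x => f x - g x) h = ip f h - ip g h.
Proof.
move=> sf sg sh; rewrite -[in RHS]mulN1r -ipZl// -ipDl//; last exact: sqintZ.
by rewrite /ip; apply: eq_Rintegral => x _; rewrite mulN1r.
Qed.

Lemma ip_suml (I : Type) (r : seq I) (f : I -> X -> R) h :
  (forall i, sqint (f i)) -> sqint h ->
  ip (fun x => \sum_(i <- r) f i x) h = \sum_(i <- r) ip (f i) h.
Proof.
move=> sf sh; elim: r => [|i r IH].
  rewrite big_nil /ip; under eq_Rintegral do rewrite big_nil mul0r.
  by rewrite Rintegral_cst// mul0r.
rewrite big_cons -IH -ipDl//; last exact: sqint_sum.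
by rewrite /ip; apply: eq_Rintegral => x _; rewrite big_cons.
Qed.

Lemma ip_sqrB f g : sqint f -> sqint g ->
  ip (fun x => f x - g x) (fun x => f x - g x) = ip f f - 2 * ip f g + ip g g.
Proof.
move=> sf sg; have sfg := sqintB sf sg.
rewrite ipBl// [ip f (fun x => _ - _)]ipC [ip g (fun x => _ - _)]ipC !ipBl//.
by rewrite [ip g f]ipC; ring.
Qed.

Lemma ip_sqrD f g : sqint f -> sqint g ->
  ip (fun x => f x + g x) (fun x => f x + g x) = ip f f + 2 * ip f g + ip g g.
Proof.
move=> sf sg; have sfg := sqintD sf sg.
rewrite ipDl// [ip f (fun x => _ + _)]ipC [ip g (fun x => _ + _)]ipC !ipDl//.
by rewrite [ip g f]ipC; ring.
Qed.

Lemma ip_ge0 f : 0 <= ip f f.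
Proof. by apply: Rintegral_ge0 => x _; rewrite -expr2 sqr_ge0. Qed.

Variables (T : R) (I : finType) (e : I -> X -> R).
Hypothesis T0 : 0 < T.
Hypothesis se : forall i, sqint (e i).
Hypothesis orth : forall i j, ip (e i) (e j) = T *+ (i == j).

(** Squared distance from h to the span of the e i, each of which has squared norm T. *)
Definition defect h : R := ip h h - (\sum_i ip h (e i) ^+ 2) / T.

(** The orthogonal projection g of h has <g, g> = <g, h>, so the defect is the squared norm of h -
    g. *)
Lemma defect_ge0 h : sqint h -> 0 <= defect h.
Proof.
move=> sh; pose c i := ip h (e i) / T.
pose g x := \sum_i c i * e i x.
have sce i : sqint (fun x => c i * e i x) by exact: sqintZ.
have sg : sqint g by exact: sqint_sum.
have := ip_ge0 (fun x => h x - g x).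
have gh : ip g h = (\sum_i ip h (e i) ^+ 2) / T.
  rewrite ip_suml// mulr_suml; apply: eq_bigr => i _.
  by rewrite ipZl// /c ipC; ring.
have gg : ip g g = (\sum_i ip h (e i) ^+ 2) / T.
  rewrite {1}/g ip_suml// mulr_suml; apply: eq_bigr => i _.
  rewrite ipZl// ipC /g ip_suml// (bigD1 i)//= big1 => [|j ji]; last first.
    by rewrite ipZl// orth (negbTE ji) mulr0.
  by rewrite ipZl// orth eqxx mulr1n addr0 /c; field; rewrite gt_eqF.
by rewrite ip_sqrB// [ip h g]ipC gh gg /defect; lra.
Qed.

(** The defect is a quadratic form, hence obeys the parallelogram law; the nonnegative defect of f -
    g is dropped. *)
Lemma defectD f g : sqint f -> sqint g ->
  defect (fun x => f x + g x) <= 2 * (defect f + defect g).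
Proof.
move=> sf sg; have := defect_ge0 (sqintB sf sg).
have sfg := sqintD sf sg; have sgf := sqintB sf sg.
rewrite /defect ip_sqrB// ip_sqrD//.
have -> : \sum_i ip (fun x => f x + g x) (e i) ^+ 2 =
   2 * (\sum_i ip f (e i) ^+ 2 + \sum_i ip g (e i) ^+ 2) -
   \sum_i ip (fun x => f x - g x) (e i) ^+ 2.
  rewrite mulrDr !mulr_sumr -big_split -sumrB/=; apply: eq_bigr => i _.
  by rewrite ipDl// ipBl//; ring.
lra.
Qed.

Lemma defectZ k f : sqint f -> defect (fun x => k * f x) = k ^+ 2 * defect f.
Proof.
move=> sf; have skf := sqintZ k sf.
rewrite /defect ipZl// [ip f _]ipC ipZl// mulrA -expr2 mulrBr mulrA mulr_sumr.
by congr (_ - _ / _); apply: eq_bigr => i _; rewrite ipZl// exprMn.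
Qed.

Lemma defect_le f : defect f <= ip f f.
Proof.
by rewrite lerBlDr lerDl divr_ge0 ?(ltW T0)// sumr_ge0// => i _; exact: sqr_ge0.
Qed.

Lemma defect_basis i : defect (e i) = 0.
Proof.
rewrite /defect (bigD1 i)//= big1 => [|j ji]; last first.
  by rewrite orth eq_sym (negbTE ji) mulr0n expr0n.
by rewrite orth eqxx mulr1n addr0 expr2 mulfK ?subrr// gt_eqF.
Qed.

End L2.

Section Bounded.
Context (dsp : measure_display) (X : measurableType dsp) (R : realType).
Variables (mu : {measure set X -> \bar R}) (D : set X).

Lemma integrable_bounded (f : X -> R) (M : R) : measurable D -> (mu D < +oo)%E ->
  measurable_fun D f -> (forall x, D x -> `|f x| <= M) ->
  mu.-integrable D (EFin \o f).
Proof.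
move=> mD fD mf fM; apply: measurable_bounded_integrable => //.
exists M; split; first exact: num_real.
by move=> N MN x Dx; apply: le_trans (ltW MN); exact: fM.
Qed.

Lemma sqint_bounded (f : X -> R) (M : R) : measurable D -> (mu D < +oo)%E ->
  measurable_fun D f -> (forall x, D x -> `|f x| <= M) -> sqint mu D f.
Proof.
move=> mD fD mf fM; split => //.
apply: (@integrable_bounded _ (M ^+ 2)) => //.
  exact: measurable_funX.
by move=> x Dx; rewrite normrX lerXn2r ?nnegrE ?fM// (le_trans _ (fM x Dx)).
Qed.

Lemma sqint_mul_bounded (f g : X -> R) (M : R) : measurable D ->
  measurable_fun D g -> (forall x, D x -> `|g x| <= M) -> sqint mu D f ->
  sqint mu D (fun x => f x * g x).
Proof.
move=> mD mg gM [mf f2]; split; first exact: measurable_funM.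
apply: (@le_integrable _ _ _ mu D mD _ (EFin \o (fun x => M ^+ 2 * f x ^+ 2))).
- by apply/measurable_EFinP; apply: measurable_funX; exact: measurable_funM.
- move=> x Dx /=; rewrite lee_fin -!exprMn !ger0_norm ?sqr_ge0// !exprMn mulrC.
  rewrite ler_wpM2r ?sqr_ge0// -[g x ^+ 2]real_normK ?num_real//.
  have M0 : 0 <= M by rewrite (le_trans _ (gM x Dx)).
  by rewrite lerXn2r ?nnegrE ?gM.
- have := integrableZl mD (M ^+ 2) f2.
  by apply: eq_integrable => // x xD /=; rewrite -EFinM.
Qed.

End Bounded.

(** * Integrals of cosines and sines *)

Section TrigIntegrals.
Variable R : realType.
Local Notation mu := (@lebesgue_measure R).

Lemma measurable_cos_affine (D : set R) (a b : R) :
  measurable_fun D (fun s => cos (a * s + b)).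
Proof.
apply: measurable_funTS; apply: continuous_measurable_fun => x.
apply: (@continuous_comp _ _ _ (fun s => a * s + b) cos); last exact: continuous_cos.
by apply: continuousD; [apply: mulrl_continuous|exact: cst_continuous].
Qed.

Lemma measurable_sin_affine (D : set R) (a b : R) :
  measurable_fun D (fun s => sin (a * s + b)).
Proof.
apply: measurable_funTS; apply: continuous_measurable_fun => x.
apply: (@continuous_comp _ _ _ (fun s => a * s + b) sin); last exact: continuous_sin.
by apply: continuousD; [apply: mulrl_continuous|exact: cst_continuous].
Qed.

Lemma measurable_cosM (D : set R) (a : R) : measurable_fun D (fun s => cos (a * s)).
Proof.
by have := @measurable_cos_affine D a 0; under eq_fun do rewrite addr0.
Qed.

Lemma measurable_sinM (D : set R) (a : R) : measurable_fun D (fun s => sin (a * s)).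
Proof.
by have := @measurable_sin_affine D a 0; under eq_fun do rewrite addr0.
Qed.

Lemma lebesgue_itvco_fin (a b : R) : (mu `[a, b[%classic < +oo)%E.
Proof. by rewrite lebesgue_measure_itv/=; case: ifP => _; rewrite ?ltry. Qed.

(** Half-open intervals are used because their translates tile the line. The fundamental theorem is
    applied on the closed interval, which differs by a point. *)
Lemma Rintegral_FTC_itvco (f F : R -> R) (T M : R) : 0 < T ->
  (forall x : R, is_derive x 1 F (f x)) -> continuous f ->
  (forall x, `|f x| <= M) ->
  \int[mu]_(s in `[0, T[%classic) f s = F T - F 0.
Proof.
move=> T0 dF cf fM.
have cF : continuous F.
  by move=> x; apply/differentiable_continuous/derivable1_diffP; case: (dF x).
rewrite Rintegral_itv_bndo_bndc; last first.
  apply: (@integrable_bounded _ _ _ _ _ _ M) => //; first exact: lebesgue_itvco_fin.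
  by apply: measurable_funTS; exact: continuous_measurable_fun.
rewrite /Rintegral (@continuous_FTC2 _ f F)//.
- exact: continuous_subspaceT.
- split; first by move=> x _; case: (dF x).
    by apply: cvg_at_right_filter; exact: cF.
  by apply: cvg_at_left_filter; exact: cF.
- by move=> x _; rewrite derive1E; case: (dF x).
Qed.


Lemma is_derive_sinM (a x : R) : is_derive x 1 (fun s => sin (a * s)) (a * cos (a * x)).
Proof.
have h : is_derive x 1 (fun s : R => a * s) a.
  by apply: is_derive_eq; rewrite /GRing.scale/= mulr1.
apply: (@is_derive_eq _ _ _ _ _ _ _ _ (is_derive1_comp (is_derive_sin (a * x)) h)).
by rewrite mulrC.
Qed.

Lemma is_derive_cosM (a x : R) : is_derive x 1 (fun s => cos (a * s)) (- (a * sin (a * x))).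
Proof.
have h : is_derive x 1 (fun s : R => a * s) a.
  by apply: is_derive_eq; rewrite /GRing.scale/= mulr1.
apply: (@is_derive_eq _ _ _ _ _ _ _ _ (is_derive1_comp (is_derive_cos (a * x)) h)).
by rewrite mulNr mulrC.
Qed.

Lemma continuous_cosM (a : R) : continuous (fun s => cos (a * s)).
Proof.
move=> x; apply: (@continuous_comp _ _ _ (fun s => a * s) cos).
  exact: mulrl_continuous.
exact: continuous_cos.
Qed.

Lemma continuous_sinM (a : R) : continuous (fun s => sin (a * s)).
Proof.
move=> x; apply: (@continuous_comp _ _ _ (fun s => a * s) sin).
  exact: mulrl_continuous.
exact: continuous_sin.
Qed.

Lemma Rintegral_cosM (a T : R) : 0 < T -> a != 0 ->
  \int[mu]_(s in `[0, T[%classic) cos (a * s) = sin (a * T) / a.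
Proof.
move=> T0 a0.
have dF (x : R) : is_derive x 1 (a^-1 \*: (fun s => sin (a * s) : R^o)) (cos (a * x)).
  apply: (@is_derive_eq _ _ _ _ _ _ _ _ (is_deriveZ _ (is_derive_sinM a x))).
  by rewrite /GRing.scale/= mulKf.
rewrite (Rintegral_FTC_itvco T0 dF (@continuous_cosM a) (fun x => cos_max (a * x)))/=.
by rewrite mulr0 sin0 scaler0 subr0 [RHS]mulrC.
Qed.

Lemma Rintegral_sinM (a T : R) : 0 < T -> a != 0 ->
  \int[mu]_(s in `[0, T[%classic) sin (a * s) = (1 - cos (a * T)) / a.
Proof.
move=> T0 a0.
have dF (x : R) : is_derive x 1 ((- a^-1) \*: (fun s => cos (a * s) : R^o)) (sin (a * x)).
  apply: (@is_derive_eq _ _ _ _ _ _ _ _ (is_deriveZ _ (is_derive_cosM a x))).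
  by rewrite /GRing.scale/= mulrNN mulKf.
rewrite (Rintegral_FTC_itvco T0 dF (@continuous_sinM a) (fun x => sin_max (a * x)))/=.
by rewrite mulr0 cos0 /GRing.scale/=; field.
Qed.

Lemma cos_int2pi (p : int) : cos (p%:~R * (2 * pi)) = 1 :> R.
Proof.
have h (n : nat) : cos (n%:R * (2 * pi)) = 1 :> R.
  have := periodicn (@cosD2pi R) n 0; rewrite add0r cos0 => E; rewrite -[RHS]E; congr cos.
  by rewrite -[pi *+ 2 *+ n]mulr_natl -[pi *+ 2]mulr_natl.
case: p => n; first exact: h.
by rewrite NegzE mulrNz mulNr cosN; exact: h.
Qed.

Lemma sin_int2pi (p : int) : sin (p%:~R * (2 * pi)) = 0 :> R.
Proof.
have h (n : nat) : sin (n%:R * (2 * pi)) = 0 :> R.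
  have := periodicn (@sinD2pi R) n 0; rewrite add0r sin0 => E; rewrite -[RHS]E; congr sin.
  by rewrite -[pi *+ 2 *+ n]mulr_natl -[pi *+ 2]mulr_natl.
case: p => n; first exact: h.
by rewrite NegzE mulrNz mulNr sinN h oppr0.
Qed.

End TrigIntegrals.

(** * The system cos + sin *)

Section Cas.
Variables (R : realType) (T : R).
Hypothesis T0 : 0 < T.
Local Notation mu := (@lebesgue_measure R).
Local Notation I := (`[0, T[%classic : set R).
Local Notation w := (2 * pi / T).

(** The Hartley kernel. Over all p in Z these functions are orthogonal with one common squared norm
    T, so a single real family replaces the cosines and sines with their exceptional constant
    term. *)
Definition cas (p : int) (s : R) : R :=
  cos (p%:~R * (2 * pi / T) * s) + sin (p%:~R * (2 * pi / T) * s).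

Lemma Rintegral_cos_period (p : int) :
  \int[mu]_(s in I) cos (p%:~R * w * s) = T *+ (p == 0).
Proof.
have [->|p0] := eqVneq p 0.
  under eq_Rintegral do rewrite !mul0r cos0.
  rewrite Rintegral_cst// mul1r.
  have muI : mu I = T%:E by rewrite lebesgue_measure_itv/= lte_fin T0 sube0.
  exact: (congr1 fine muI).
have w0 : p%:~R * w != 0.
  by rewrite !mulf_neq0 ?invr_eq0 ?intr_eq0// gt_eqF ?pi_gt0.
rewrite Rintegral_cosM// mulr0n.
by rewrite -!mulrA mulVf ?gt_eqF// mulr1 sin_int2pi mul0r.
Qed.

Lemma Rintegral_sin_period (p : int) :
  \int[mu]_(s in I) sin (p%:~R * w * s) = 0.
Proof.
have [->|p0] := eqVneq p 0.
  under eq_Rintegral do rewrite !mul0r sin0.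
  by rewrite Rintegral_cst// mul0r.
have w0 : p%:~R * w != 0.
  by rewrite !mulf_neq0 ?invr_eq0 ?intr_eq0// gt_eqF ?pi_gt0.
rewrite Rintegral_sinM//.
by rewrite -!mulrA mulVf ?gt_eqF// mulr1 cos_int2pi subrr mul0r.
Qed.

(** Over a period the sine always integrates to 0 and the cosine does unless p = q: this is
    orthogonality. *)
Lemma casM (p q : int) s :
  cas p s * cas q s = cos ((p - q)%:~R * w * s) + sin ((p + q)%:~R * w * s).
Proof.
have -> : (p - q)%:~R * w * s = p%:~R * w * s - q%:~R * w * s.
  by rewrite intrD mulrNz; ring.
have -> : (p + q)%:~R * w * s = p%:~R * w * s + q%:~R * w * s.
  by rewrite intrD; ring.
by rewrite cosB sinD /cas; ring.
Qed.

Lemma measurable_cas p D : measurable_fun D (cas p).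
Proof. by apply: measurable_funD; [exact: measurable_cosM|exact: measurable_sinM]. Qed.

Lemma cas_le2 p s : `|cas p s| <= 2.
Proof.
apply: le_trans (ler_normD _ _) _.
by have := cos_max (p%:~R * w * s); have := sin_max (p%:~R * w * s); lra.
Qed.

Lemma sqint_cas p : sqint mu I (cas p).
Proof.
apply: (@sqint_bounded _ _ _ _ _ _ 2) => //; first exact: lebesgue_itvco_fin.
- exact: measurable_cas.
- by move=> x _; exact: cas_le2.
Qed.

Lemma integrable_cosM_itvco a : mu.-integrable I (EFin \o (fun s => cos (a * s))).
Proof.
apply: (@integrable_bounded _ _ _ _ _ _ 1) => //; first exact: lebesgue_itvco_fin.
- exact: measurable_cosM.
- by move=> x _; exact: cos_max.
Qed.

Lemma integrable_sinM_itvco a : mu.-integrable I (EFin \o (fun s => sin (a * s))).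
Proof.
apply: (@integrable_bounded _ _ _ _ _ _ 1) => //; first exact: lebesgue_itvco_fin.
- exact: measurable_sinM.
- by move=> x _; exact: sin_max.
Qed.

Lemma ip_cas p q : ip mu I (cas p) (cas q) = T *+ (p == q).
Proof.
rewrite /ip; under eq_Rintegral do rewrite casM.
rewrite RintegralD//; [|exact: integrable_cosM_itvco|exact: integrable_sinM_itvco].
by rewrite Rintegral_cos_period Rintegral_sin_period addr0 subr_eq0.
Qed.

(* 0, -1, 1, -2, 2, ...: the first 2M + 1 values form the symmetric interval
   [-M, M]. *)
Definition zenum (k : nat) : int := if odd k then Negz k./2 else Posz k./2.

Lemma zenum_inj : injective zenum.
Proof.
move=> j k; rewrite /zenum => E.
rewrite -(odd_double_half j) -(odd_double_half k); move: E.
by case: (odd j); case: (odd k) => // -[->].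
Qed.

Lemma zenum_surj p : exists k, zenum k = p.
Proof.
case: p => n; first by exists n.*2; rewrite /zenum odd_double doubleK.
by exists n.*2.+1; rewrite /zenum /= odd_double/= uphalf_double.
Qed.

Definition cas_basis (M : nat) (k : 'I_M) : R -> R := cas (zenum k).

Definition cas_defect (M : nat) (h : R -> R) : R :=
  defect mu I T (@cas_basis M) h.

Let se M (k : 'I_M) : sqint mu I (cas_basis k).
Proof. exact: sqint_cas. Qed.

Let orth M (j k : 'I_M) : ip mu I (cas_basis j) (cas_basis k) = T *+ (j == k).
Proof. by rewrite ip_cas (inj_eq zenum_inj). Qed.

Let mI : measurable I.
Proof. by []. Qed.

Lemma cas_defect_ge0 M h : sqint mu I h -> 0 <= cas_defect M h.
Proof. by move=> sh; have := defect_ge0 (mu := mu) mI T0 (@se M) (@orth M) sh. Qed.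

Lemma cas_defect_mono M N h : (M <= N)%N -> cas_defect N h <= cas_defect M h.
Proof.
move=> MN; rewrite lerD2l lerN2 ler_pM2r ?invr_gt0//.
rewrite -(big_mkord predT (fun k => ip mu I h (cas (zenum k)) ^+ 2)).
rewrite -[leRHS](big_mkord predT (fun k => ip mu I h (cas (zenum k)) ^+ 2)).
rewrite [leRHS](big_cat_nat (n := M))//= lerDl.
by apply: sumr_ge0 => k _; exact: sqr_ge0.
Qed.

(** Membership in the closed span of the system; one M for each e is enough because the defect
    decreases in M. *)
Definition fourier_good (h : R -> R) := sqint mu I h /\
  forall e : R, 0 < e -> exists M, cas_defect M h <= e.

Lemma fourier_goodD f g : fourier_good f -> fourier_good g ->
  fourier_good (fun s => f s + g s).
Proof.
move=> [sf ff] [sg gg]; split; first exact: sqintD.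
move=> e e0; have e4 : 0 < e / 4 by lra.
have [M HM] := ff _ e4; have [N HN] := gg _ e4.
exists (maxn M N).
have := defectD (mu := mu) mI T0 (@se (maxn M N)) (@orth (maxn M N)) sf sg.
have := cas_defect_mono f (leq_maxl M N); have := cas_defect_mono g (leq_maxr M N).
rewrite /cas_defect in HM HN *; lra.
Qed.

Lemma fourier_goodZ c f : fourier_good f -> fourier_good (fun s => c * f s).
Proof.
move=> [sf ff]; split; first exact: sqintZ.
(* The added 1 avoids a division by zero when c = 0. *)
move=> e e0; have c0 : 0 < c ^+ 2 + 1 by have := sqr_ge0 c; lra.
have [M HM] := ff (e / (c ^+ 2 + 1)) (divr_gt0 e0 c0); exists M.
rewrite /cas_defect (defectZ (mu := mu) mI T (@se M))//.
move: HM; rewrite ler_pdivlMr// => HM.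
have := cas_defect_ge0 M sf; rewrite /cas_defect in HM *; lra.
Qed.

Lemma fourier_good_cas p : fourier_good (cas p).
Proof.
split; first exact: sqint_cas.
move=> e e0; have [k kp] := zenum_surj p; exists k.+1.
have := defect_basis T0 (@orth k.+1) (Ordinal (ltnSn k)).
by rewrite /cas_basis/= kp /cas_defect => ->; exact: ltW.
Qed.

(** Write h = (h - g) + g; the defect of h - g is at most its squared norm. *)
Lemma fourier_good_closed (h : R -> R) : sqint mu I h ->
  (forall e, 0 < e -> exists g, fourier_good g /\
     ip mu I (fun s => h s - g s) (fun s => h s - g s) <= e) -> fourier_good h.
Proof.
move=> sh H; split => // e e0; have e4 : 0 < e / 4 by lra.
have [g [[sg gg] hg]] := H _ e4; have [M HM] := gg _ e4; exists M.
have shg := sqintB (mu := mu) mI sh sg.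
have := defectD (mu := mu) mI T0 (@se M) (@orth M) shg sg.
rewrite (_ : (fun x => h x - g x + g x) = h); last first.
  by apply/funext => x; rewrite subrK.
have := @defect_le _ _ _ mu I T _ (@cas_basis M) T0 (fun s => h s - g s).
rewrite /cas_defect in HM *; lra.
Qed.

(** Dominated convergence for (h - g k)^2 with majorant F^2. Convergence is asked almost everywhere
    because the step approximation fails at the ends of an interval. *)
Lemma fourier_good_lim (h F : R -> R) (g : nat -> R -> R) :
  sqint mu I h -> (forall k, fourier_good (g k)) -> sqint mu I F ->
  (forall k s, I s -> `|h s - g k s| <= F s) ->
  {ae mu, forall s, I s -> (g k s) @[k --> \oo] --> h s} ->
  fourier_good h.
Proof.
move=> sh gg sF hF cg; apply: fourier_good_closed => // e e0.
have sk k : sqint mu I (fun s => h s - g k s) by apply: sqintB => //; case: (gg k).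
have [|||||_ _] := @dominated_convergence _ _ _ mu I mI
  (fun k s => ((h s - g k s) ^+ 2)%:E) (cst 0%E) (EFin \o (fun s => F s ^+ 2)).
- by move=> k; apply/measurable_EFinP; apply: measurable_funX; case: (sk k).
- exact: measurable_cst.
- case: cg => N [mN N0 subN]; exists N; split => // s /= ns; apply: subN => /= cgs.
  apply: ns => Is /=; move/(_ Is) : cgs => cgs.
  have e2 : (0 : \bar R)%E = (0 ^+ 2)%:E by rewrite expr0n.
  rewrite [X in _ --> X]e2.
  apply/fine_cvgP; split; first exact: nearW.
  rewrite [X in X @ _ --> _](_ : _ = (fun k => (h s - g k s) ^+ 2))//.
  apply: (@continuous_cvg _ _ _ _ _ (fun k => h s - g k s) (fun x : R => x ^+ 2)).
    exact: exprn_continuous.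
  rewrite -(subrr (h s)); apply: cvgB => //; exact: cvg_cst.
- by case: sF.
- apply: aeW => s k Is /=; rewrite lee_fin normrX.
  by rewrite lerXn2r ?nnegrE ?hF// (le_trans _ (hF k s Is)).
rewrite integral0 => /fine_cvgP[_] /cvgrPdist_lt /(_ _ e0)[N _ /(_ N (leqnn N))].
rewrite /= sub0r normrN => HN; exists (g N); split => //.
apply: (le_trans (ler_norm _)); apply: ltW; rewrite /ip.
by under eq_Rintegral do rewrite -expr2.
Qed.

End Cas.

(** * Completeness of the trigonometric system *)

Section StepPolynomial.
Variable R : realType.

(** For x = y^k and N = 2^k the product N x = (2 y)^k decides: (1 - x)^N tends to 1 if it vanishes
    and to 0 if it explodes, hence the threshold 1/2. Such polynomials occur in elementary proofs of
    the Stone-Weierstrass theorem. *)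
Definition step_poly (k : nat) (y : R) : R := 1 - (1 - y ^+ k) ^+ (2 ^ k).

Lemma bernoulli_ineq (x : R) (n : nat) : 0 <= x <= 1 -> 1 - n%:R * x <= (1 - x) ^+ n.
Proof.
move=> /andP[x0 x1]; elim: n => [|n IH]; first by rewrite mul0r subr0 expr0.
have h : (1 - x) * (1 - n%:R * x) <= (1 - x) * (1 - x) ^+ n.
  by rewrite ler_wpM2l// subr_ge0.
rewrite exprS; apply: le_trans h; rewrite -natr1.
have : 0 <= n%:R * x * x by rewrite !mulr_ge0.
lra.
Qed.

(** The left side decreases in n, since (1 - x) * (1 + (n + 1) x) <= 1 + n x. *)
Lemma exp_onem_le (x : R) (n : nat) : 0 <= x <= 1 ->
  (1 - x) ^+ n * (1 + n%:R * x) <= 1.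
Proof.
move=> /andP[x0 x1]; elim: n => [|n IH]; first by rewrite mul0r addr0 mulr1 expr0.
apply: le_trans IH; rewrite exprS -natr1 [(1 - x) * _]mulrC -mulrA.
rewrite ler_wpM2l ?exprn_ge0 ?subr_ge0//.
have : 0 <= n%:R * x * x by rewrite !mulr_ge0.
have : 0 <= x * x by rewrite mulr_ge0.
lra.
Qed.

Lemma step_poly_bound k (y : R) : 0 <= y <= 1 -> 0 <= step_poly k y <= 1.
Proof.
move=> /andP[y0 y1].
have yk : 0 <= 1 - y ^+ k <= 1.
  by rewrite subr_ge0 exprn_ile1//= lerBlDr lerDl exprn_ge0.
have : 0 <= (1 - y ^+ k) ^+ (2 ^ k) <= 1.
  by case/andP: yk => *; rewrite exprn_ge0//= exprn_ile1.
rewrite /step_poly; lra.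
Qed.

Lemma step_poly_lo (y : R) : 0 <= y < 1 / 2 -> step_poly k y @[k --> \oo] --> (0 : R).
Proof.
move=> /andP[y0 y1].
have y01 : 0 <= y <= 1 by rewrite y0/=; lra.
apply: (@squeeze_cvgr _ _ _ _ (cst 0) (fun k => (2 * y) ^+ k)).
- apply: nearW => k; have /andP[-> _]/= := step_poly_bound k y01.
  have yk : 0 <= y ^+ k <= 1 by rewrite exprn_ge0//= exprn_ile1//; lra.
  have := bernoulli_ineq (2 ^ k)%N yk; rewrite natrX -exprMn /step_poly; lra.
- exact: cvg_cst.
- by apply: cvg_expr; rewrite ger0_norm; lra.
Qed.

Lemma step_poly_hi (y : R) : 1 / 2 < y <= 1 -> step_poly k y @[k --> \oo] --> (1 : R).
Proof.
move=> /andP[y0 y1].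
have y01 : 0 <= y <= 1 by rewrite y1 andbT; lra.
have y2 : 0 < 2 * y by lra.
apply: (@squeeze_cvgr _ _ _ _ (fun k => 1 - ((2 * y)^-1) ^+ k) (cst 1)).
- apply: nearW => k; have /andP[_ ->]/= := step_poly_bound k y01.
  have yk : 0 <= y ^+ k <= 1 by rewrite exprn_ge0//= ?exprn_ile1//; lra.
  have := exp_onem_le (2 ^ k)%N yk; rewrite natrX -exprMn /step_poly.
  set A := (1 - y ^+ k) ^+ _; have A0 : 0 <= A.
    by rewrite exprn_ge0// subr_ge0; case/andP: yk.
  have z0 : 0 < (2 * y) ^+ k by rewrite exprn_gt0.
  rewrite exprVn andbT => h; rewrite lerD2l lerN2 -[leRHS]mul1r ler_pdivlMr//; lra.
- rewrite -[X in _ --> X]subr0; apply: cvgB; first exact: cvg_cst.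
  apply: cvg_expr; rewrite ger0_norm ?invr_ge0 ?(ltW y2)//.
  by rewrite invf_lt1//; lra.
- exact: cvg_cst.
Qed.

End StepPolynomial.

Section Completeness.
Variables (R : realType) (T : R).
Hypothesis T0 : 0 < T.
Local Notation mu := (@lebesgue_measure R).
Local Notation I := (`[0, T[%classic : set R).
Local Notation w := (2 * pi / T).
Local Notation good := (fourier_good T).

Inductive trigpoly : (R -> R) -> Prop :=
| trigpoly_cas p : trigpoly (cas T p)
| trigpolyD f g : trigpoly f -> trigpoly g -> trigpoly (fun s => f s + g s)
| trigpolyZ c f : trigpoly f -> trigpoly (fun s => c * f s).

Lemma trigpoly_good f : trigpoly f -> good f.
Proof.
by elim=> [p|g h _ gg _ gh|c g _ gg]; [exact: fourier_good_cas|
  exact: fourier_goodD|exact: fourier_goodZ].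
Qed.

Lemma casN p (s : R) : cas T (- p) s = cos (p%:~R * w * s) - sin (p%:~R * w * s).
Proof. by rewrite /cas mulrNz !mulNr cosN sinN. Qed.

Lemma trigpolyM f g : trigpoly f -> trigpoly g -> trigpoly (fun s => f s * g s).
Proof.
move=> tf; elim: tf g => {f} [p|f1 f2 _ h1 _ h2|c f _ h] g tg; last 2 first.
- have -> : (fun s => (f1 s + f2 s) * g s) = (fun s => f1 s * g s + f2 s * g s).
    by apply/funext => s; rewrite mulrDl.
  by apply: trigpolyD; [exact: h1|exact: h2].
- have -> : (fun s => c * f s * g s) = (fun s => c * (f s * g s)).
    by apply/funext => s; rewrite mulrA.
  by apply: trigpolyZ; exact: h.
elim: tg => {g} [q|f1 f2 _ h1 _ h2|c f _ h].
(* Cosine and sine are half the sum and half the difference of [cas] at opposite frequencies. *)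
- have -> : (fun s => cas T p s * cas T q s) = (fun s =>
     (1 / 2 * cas T (p - q) s + 1 / 2 * cas T (- (p - q)) s) +
     (1 / 2 * cas T (p + q) s + (- (1 / 2)) * cas T (- (p + q)) s)).
    by apply/funext => s; rewrite casM !casN {1 2}/cas; lra.
  by apply: trigpolyD; apply: trigpolyD; apply: trigpolyZ; exact: trigpoly_cas.
- have -> : (fun s => cas T p s * (f1 s + f2 s)) =
            (fun s => cas T p s * f1 s + cas T p s * f2 s).
    by apply/funext => s; rewrite mulrDr.
  exact: trigpolyD.
- have -> : (fun s => cas T p s * (c * f s)) = (fun s => c * (cas T p s * f s)).
    by apply/funext => s; rewrite mulrCA.
  exact: trigpolyZ.
Qed.

Lemma trigpoly_cst c : trigpoly (fun=> c).
Proof.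
have -> : (fun=> c) = (fun s => c * cas T 0 s).
  by apply/funext => s; rewrite /cas !mul0r cos0 sin0 addr0 mulr1.
exact/trigpolyZ/trigpoly_cas.
Qed.

Lemma trigpolyX f k : trigpoly f -> trigpoly (fun s => f s ^+ k).
Proof.
move=> tf; elim: k => [|k IH]; first exact: trigpoly_cst.
by under eq_fun do rewrite exprS; exact: trigpolyM.
Qed.

Lemma trigpolyB1 f : trigpoly f -> trigpoly (fun s => 1 - f s).
Proof.
move=> tf; have -> : (fun s => 1 - f s) = (fun s => 1 + (-1) * f s).
  by apply/funext => s; rewrite mulN1r.
by apply: trigpolyD; [exact: trigpoly_cst|exact: trigpolyZ].
Qed.

Lemma trigpoly_step_poly f k : trigpoly f -> trigpoly (fun s => step_poly k (f s)).
Proof. by move=> tf; apply/trigpolyB1/trigpolyX/trigpolyB1/trigpolyX. Qed.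

Lemma trigpoly_cos_shift t : trigpoly (fun s => cos (w * s - t)).
Proof.
have -> : (fun s => cos (w * s - t)) = (fun s =>
   cos t / 2 * (cas T 1 s + cas T (- 1) s) +
   sin t / 2 * (cas T 1 s + (-1) * cas T (- 1) s)).
  apply/funext => s; rewrite cosB casN /cas !mul1r.
  lra.
by apply: trigpolyD; apply: trigpolyZ; apply: trigpolyD; do ?apply: trigpolyZ;
  exact: trigpoly_cas.
Qed.

Lemma fourier_good_cst c : good (fun=> c).
Proof. exact/trigpoly_good/trigpoly_cst. Qed.

Lemma fourier_good_eq f g : {in I, f =1 g} -> good f -> good g.
Proof.
move=> fg [[mf f2] ff].
have sg : sqint mu I g.
  split; first by apply: eq_measurable_fun mf.
  by apply: eq_integrable f2 => // x xI /=; rewrite fg.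
apply: (fourier_good_closed T0 sg) => e e0; exists f; split => //.
rewrite /ip (@eq_Rintegral _ _ _ _ _ (fun=> 0)) ?Rintegral_cst ?mul0r ?(ltW e0)//.
by move=> x xI; rewrite fg// subrr mul0r.
Qed.

Lemma fourier_good_sum (J : Type) (r : seq J) (f : J -> R -> R) :
  (forall i, good (f i)) -> good (fun s => \sum_(i <- r) f i s).
Proof.
move=> gf; elim: r => [|i r IH].
  by under eq_fun do rewrite big_nil; exact: fourier_good_cst.
by under eq_fun do rewrite big_cons; exact: fourier_goodD.
Qed.

(** w * b / 2 is the midpoint of the arc from 0 to w * b, and the cosine of the distance to it tells
    whether a point of the circle is on the arc. At s = 0 and s = b both sides are equal. *)
Lemma cos_threshold (b s : R) : 0 < b <= T -> 0 <= s < T -> s != 0 -> s != b ->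
  (s < b -> cos (w * b / 2) < cos (w * s - w * b / 2)) /\
  (b < s -> cos (w * s - w * b / 2) < cos (w * b / 2)).
Proof.
move=> /andP[b0 bT] /andP[s0 sT] sn0 snb.
have w0 : 0 < w by rewrite divr_gt0// mulr_gt0// pi_gt0.
have wT : w * T = 2 * pi by rewrite divfK// gt_eqF.
have wb0 : 0 < w * b by rewrite mulr_gt0.
have pb : 0 < pi :> R by exact: pi_gt0.
have wbT : w * b <= w * T by rewrite ler_pM2l.
have ws0 : 0 < w * s by rewrite mulr_gt0// lt_def sn0.
have wsT : w * s < w * T by rewrite ltr_pM2l.
rewrite wT in wbT wsT.
have hb : w * b / 2 \in `[0, pi] by rewrite in_itv/=; apply/andP; split; lra.
split => h.
  have wsb : w * s < w * b by rewrite ltr_pM2l.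
  rewrite -(cos_norm (w * s - _)) ltr_cos//.
    by rewrite ltr_norml; apply/andP; split; lra.
  by rewrite in_itv/= normr_ge0/= ler_norml; apply/andP; split; lra.
have wsb : w * b < w * s by rewrite ltr_pM2l.
have [hp|hp] := leP (w * s - w * b / 2) pi.
  by rewrite ltr_cos ?in_itv/=; do ?[by apply/andP; split; lra]; lra.
(* Angles beyond pi are reflected into [0, pi], where the cosine decreases. *)
have -> : cos (w * s - w * b / 2) = cos (2 * pi - (w * s - w * b / 2)).
  by rewrite [2 * pi - _]addrC mulr_natl cosD2pi cosN.
by rewrite ltr_cos ?in_itv/=; do ?[by apply/andP; split; lra]; lra.
Qed.

Lemma sqint_indic (A : set R) : measurable A -> sqint mu I (\1_A : R -> R).
Proof.
move=> mA; apply: (@sqint_bounded _ _ _ _ _ _ 1) => //.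
- exact: lebesgue_itvco_fin.
- by move=> x _; rewrite indicE; case: (_ \in _); rewrite ?normr1 ?normr0.
Qed.

Lemma fourier_good_ray (b : R) : 0 < b <= T -> good (\1_(`]-oo, b[%classic) : R -> R).
Proof.
(* Affine rescaling that keeps y in [0, 1] and sends the threshold cos (w * b / 2) to 1 / 2. *)
move=> b0T; pose y s : R := (cos (w * s - w * b / 2) - cos (w * b / 2) + 2) / 4.
have y01 s : 0 <= y s <= 1.
  have := cos_max (w * s - w * b / 2); have := cos_max (w * b / 2).
  by rewrite /y !ler_norml => /andP[? ?] /andP[? ?]; apply/andP; split; lra.
have ty : trigpoly y.
  have -> : y = (fun s => 1 / 4 * (cos (w * s - w * b / 2) + (2 - cos (w * b / 2)))).
    by apply/funext => s; rewrite /y; lra.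
  by apply/trigpolyZ/trigpolyD; [exact: trigpoly_cos_shift|exact: trigpoly_cst].
apply: (@fourier_good_lim _ _ T0 _ (fun=> 1) (fun k s => step_poly k (y s))).
- exact: sqint_indic.
- by move=> k; exact/trigpoly_good/trigpoly_step_poly.
- by case: (fourier_good_cst 1).
- move=> k s _; have /andP[h0 h1] := step_poly_bound k (y01 s).
  by rewrite indicE; case: (_ \in _); rewrite ler_norml /=; lra.
- exists [set 0; b]; split; first by exact: measurableU.
    by apply: null_set_setU => //; exact: lebesgue_measure_set1.
  move=> s /=; apply: contra_notP => /not_orP[/eqP s0 /eqP sb] Is.
  have Is' : 0 <= s < T by move: Is; rewrite /= in_itv.
  have [hlo hhi] := cos_threshold b0T Is' s0 sb.
  rewrite indicE; have [slb|sgb|sbE] := ltgtP s b; last by rewrite sbE eqxx in sb.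
    have -> : s \in `]-oo, b[%classic by rewrite inE/= in_itv.
    apply: step_poly_hi; have := hlo slb; have /andP[_ ->] := y01 s.
    by rewrite /y andbT; lra.
  have -> : (s \in `]-oo, b[%classic) = false.
    by apply/negP; rewrite inE/= in_itv/=; lra.
  apply: step_poly_lo; have := hhi sgb; have /andP[-> _] := y01 s.
  by rewrite /y/=; lra.
Qed.

Lemma fourier_good_indic (A : set R) : measurable A -> good (\1_A : R -> R).
Proof.
move=> mA; have goodC B : good (\1_B : R -> R) -> good (\1_(~` B) : R -> R).
  move=> gB; have := fourier_goodD T0 (fourier_good_cst 1) (fourier_goodZ T0 (-1) gB).
  apply: fourier_good_eq => s _; rewrite !indicE in_setC.
  by case: (s \in B); rewrite ?mulr1 ?mulr0 ?subrr ?addr0.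
suff : forall S, <<s @RGenInftyO.G R >> S -> good (\1_S : R -> R).
  move=> H; apply: H; have E : (@measurable _ (measurableTypeR R)) =
    <<s @RGenInftyO.G R >> := RGenInftyO.measurableE R.
  by rewrite -E.
apply: (@dynkin_induction _ (measurableTypeR R)).
- exact: RGenInftyO.measurableE.
- move=> _ _ [x ->] [z ->]; exists (Num.min x z).
  by apply/seteqP; split => s /=; rewrite !in_itv/= lt_min => /andP.
- have := fourier_good_cst 1; apply: fourier_good_eq => s _.
  by rewrite indicT.
(* Within [0, T[ the ray is empty for b <= 0 and everything for b > T. *)
- move=> _ [b ->]; have [b0|b0] := leP b 0.
    have := fourier_good_cst 0; apply: fourier_good_eq => s; rewrite inE/= in_itv/=.
    move=> /andP[s0 _]; rewrite indicE (_ : (s \in _) = false)//.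
    by apply/negP; rewrite inE/= in_itv/=; lra.
  have [bT|bT] := leP b T; first by apply: fourier_good_ray; rewrite b0.
  have := fourier_good_cst 1; apply: fourier_good_eq => s; rewrite inE/= in_itv/=.
  move=> /andP[s0 sT]; rewrite indicE (_ : (s \in _) = true)//.
  by apply/mem_set; rewrite /= in_itv/=; lra.
- by move=> S _; exact: goodC.
- move=> F mF tF gF.
  (* By disjointness the indicator of a partial union is a finite sum of good functions; at each
     point these indicators are eventually constant. *)
  pose U k := \big[setU/set0]_(i < k) F i.
  have gU k : good (\1_(U k) : R -> R).
    rewrite /U; elim: k => [|k IH].
      have := fourier_good_cst 0; apply: fourier_good_eq => s _.
      by rewrite big_ord0 indic0.
    have := fourier_goodD T0 IH (gF k); apply: fourier_good_eq => s _.
    rewrite big_ord_recr/= !indicE in_setU.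
    have tF' : trivIset (fun x : nat => predT x) F.
      by move/trivIsetP: tF => tF; apply/trivIsetP => i j _ _; exact: tF.
    have := @trivIset_bigsetUI _ predT F tF' k k isT (leqnn k).
    move=> /seteqP[+ _] => /(_ s) dis.
    case: (boolP (s \in \big[setU/set0]_(i < k) F i)) => s1; case: (boolP (s \in F k)) => s2;
      rewrite /= ?addr0 ?add0r//.
    by exfalso; apply: dis; split; exact: set_mem.
  apply: (@fourier_good_lim _ _ T0 _ (fun=> 1) (fun k => \1_(U k) : R -> R)) => //.
  + by apply: sqint_indic; exact: bigcupT_measurable.
  + by case: (fourier_good_cst 1).
  + move=> k s _; rewrite !indicE; case: (_ \in _); case: (_ \in _);
    by rewrite ?subrr ?subr0 ?sub0r ?normrN ?normr1 ?normr0.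
  + apply: aeW => s _; apply: cvg_near_cst; rewrite !indicE.
    have [|ns] := boolP (s \in \bigcup_k F k).
      rewrite inE => -[i _ Fi]; exists i.+1 => // k /= ik; rewrite indicE.
      rewrite (_ : s \in U k = true)//; apply/mem_set.
      by rewrite /U -bigcup_mkord; exists i.
    exists 0%N => // k _; rewrite indicE (_ : s \in U k = false)//.
    apply: contraNF ns; rewrite !inE /U -bigcup_mkord => -[i _ Fi].
    by exists i.
Qed.

Lemma sqint_le (f g : R -> R) : measurable_fun I f -> sqint mu I g ->
  (forall s, `|f s| <= `|g s|) -> sqint mu I f.
Proof.
move=> mf [mg g2] fg; split => //.
apply: (@le_integrable _ _ _ mu I _ _ (EFin \o (fun s => g s ^+ 2))) => //.
- by apply/measurable_EFinP; exact: measurable_funX.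
- move=> x _ /=; rewrite lee_fin !normrX.
  by rewrite lerXn2r ?nnegrE ?fg.
Qed.

Import HBNNSimple.

(** The simple approximations lie between 0 and h, so h itself dominates the error. *)
Lemma fourier_good_ge0 (h : R -> R) : sqint mu I h -> (forall s, 0 <= h s) -> good h.
Proof.
move=> sh h0; have mh : measurable_fun I (EFin \o h) by apply/measurable_EFinP; case: sh.
have mI : measurable I by [].
have h0' s : I s -> (0 <= (EFin \o h) s)%E by move=> _; rewrite lee_fin.
pose g (k : nat) : R -> R := nnsfun_approx mI mh k.
apply: (fourier_good_lim T0 (h := h) (F := h) (g := g)) => //.
- move=> k.
  have -> : g k = (fun s =>
     \sum_(y <- finmap.enum_fset (fset_set (range (nnsfun_approx mI mh k))))
        y * \1_(nnsfun_approx mI mh k @^-1` [set y]) s).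
    by apply/funext => s; rewrite /g fimfunE fsbig_finite.
  apply: fourier_good_sum => y; apply: fourier_goodZ => //.
  by apply: fourier_good_indic; exact: measurable_sfunP.
- move=> k s Is.
  have le1 : nnsfun_approx mI mh k s <= h s.
    by rewrite nnsfun_approxE -lee_fin; exact: (le_approx k h0').
  have ge0 : 0 <= nnsfun_approx mI mh k s by [].
  by rewrite ger0_norm ?subr_ge0// lerBlDr lerDl.
- apply: aeW => s Is; have := cvg_nnsfun_approx mI mh h0' Is.
  by move=> /fine_cvgP[_].
Qed.

Lemma fourier_good_sqint (h : R -> R) : sqint mu I h -> good h.
Proof.
move=> sh; pose hp s := Num.max (h s) 0; pose hn s := Num.max (- h s) 0.
have mh : measurable_fun I h by case: sh.
have shp : sqint mu I hp.
  apply: (sqint_le _ sh) => [|s]; first by apply: measurable_maxr.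
  by rewrite /hp; case: (leP (h s) 0); rewrite ?normr0 ?normr_ge0.
have shn : sqint mu I hn.
  apply: (sqint_le _ sh) => [|s].
    by apply: measurable_maxr => //; exact: measurable_funN.
  by rewrite /hn; case: (leP (- h s) 0); rewrite ?normr0 ?normr_ge0 ?normrN.
have gp : good hp by apply: fourier_good_ge0 => // s; rewrite /hp le_max lexx orbT.
have gn : good hn by apply: fourier_good_ge0 => // s; rewrite /hn le_max lexx orbT.
have := fourier_goodD T0 gp (fourier_goodZ T0 (-1) gn).
apply: fourier_good_eq => s _; rewrite /hp /hn.
by case: (leP (h s) 0); case: (leP (- h s) 0) => ? ?; lra.
Qed.

End Completeness.

(** * Bessel and Parseval for complex functions *)

Section Energy.
Variables (R : realType) (T : R).
Hypothesis T0 : 0 < T.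
Local Notation mu := (@lebesgue_measure R).
Local Notation I := (`[0, T[%classic : set R).
Local Notation w := (2 * pi / T).

Lemma zenum_sumS (V : nmodType) (F : int -> V) M :
  \sum_(k < M.+1.*2.+1) F (zenum k) =
  \sum_(k < M.*2.+1) F (zenum k) + (F (- M.+1%:Z) + F M.+1%:Z).
Proof.
rewrite doubleS !big_ord_recr/= -addrA; congr (_ + (F _ + F _)).
  by rewrite /zenum/= odd_double/= uphalf_double NegzE.
by rewrite /zenum/= odd_double/= doubleK.
Qed.

(** Partial sums are cut at odd length 2M + 1 so that the frequencies are symmetric about 0 and odd
    terms cancel. *)
Lemma zenum_sum_odd (F : int -> R) M : (forall p, F (- p) = - F p) ->
  \sum_(k < M.*2.+1) F (zenum k) = 0.
Proof.
move=> FN; elim: M => [|M IH].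
  rewrite big_ord1/=; have := FN 0; rewrite oppr0 /zenum/= => h; lra.
by rewrite zenum_sumS IH FN add0r addNr.
Qed.

Definition cosint (h : R -> R) (p : int) : R := \int[mu]_(s in I) (h s * cos (p%:~R * w * s)).
Definition sinint (h : R -> R) (p : int) : R := \int[mu]_(s in I) (h s * sin (p%:~R * w * s)).

Lemma sqint_cos a : sqint mu I (fun s : R => cos (a * s)).
Proof.
apply: (@sqint_bounded _ _ _ _ _ _ 1) => //; first exact: lebesgue_itvco_fin.
- exact: measurable_cosM.
- by move=> x _; exact: cos_max.
Qed.

Lemma sqint_sin a : sqint mu I (fun s : R => sin (a * s)).
Proof.
apply: (@sqint_bounded _ _ _ _ _ _ 1) => //; first exact: lebesgue_itvco_fin.
- exact: measurable_sinM.
- by move=> x _; exact: sin_max.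
Qed.

Lemma cosintN h p : cosint h (- p) = cosint h p.
Proof. by apply: eq_Rintegral => s _; rewrite mulrNz !mulNr cosN. Qed.

Lemma sinintN h p : sqint mu I h -> sinint h (- p) = - sinint h p.
Proof.
move=> sh; rewrite /sinint -[RHS]mulN1r -RintegralZl//.
  by apply: eq_Rintegral => s _; rewrite mulrNz !mulNr sinN mul1r mulrN.
by apply: sqint_mul => //; exact: sqint_sin.
Qed.

Lemma ip_cas_cossin h p : sqint mu I h ->
  ip mu I h (cas T p) = cosint h p + sinint h p.
Proof.
move=> sh; rewrite /cosint /sinint -RintegralD//.
- by apply: eq_Rintegral => s _; rewrite /cas mulrDr.
- by apply: sqint_mul => //; exact: sqint_cos.
- by apply: sqint_mul => //; exact: sqint_sin.
Qed.

(** (c + s)^2 exceeds c^2 + s^2 by 2 c s, which is odd in p. *)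
Lemma cas_energyE h M : sqint mu I h ->
  \sum_(k < M.*2.+1) ip mu I h (cas_basis T k) ^+ 2 =
  \sum_(k < M.*2.+1) (cosint h (zenum k) ^+ 2 + sinint h (zenum k) ^+ 2).
Proof.
move=> sh; pose F p := 2 * (cosint h p * sinint h p).
have FN p : F (- p) = - F p by rewrite /F cosintN sinintN//; ring.
rewrite -[RHS]addr0 -[X in _ = _ + X](zenum_sum_odd M FN) -big_split/=; apply: eq_bigr => k _.
by rewrite ip_cas_cossin// /F; ring.
Qed.

Definition reint (A B : R -> R) (p : int) : R :=
  \int[mu]_(s in I) (A s * cos (p%:~R * w * s) - B s * sin (p%:~R * w * s)).
Definition imint (A B : R -> R) (p : int) : R :=
  \int[mu]_(s in I) (A s * sin (p%:~R * w * s) + B s * cos (p%:~R * w * s)).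

(** The cross terms of |c + i s|^2 for A + i B are odd in p as well, so completeness of the real
    system suffices for complex functions. *)
Lemma complex_energyE A B M : sqint mu I A -> sqint mu I B ->
  \sum_(k < M.*2.+1) (reint A B (zenum k) ^+ 2 + imint A B (zenum k) ^+ 2) =
  \sum_(k < M.*2.+1) ip mu I A (cas_basis T k) ^+ 2 +
  \sum_(k < M.*2.+1) ip mu I B (cas_basis T k) ^+ 2.
Proof.
move=> sA sB; rewrite !cas_energyE//.
pose F p := 2 * (sinint A p * cosint B p - cosint A p * sinint B p).
have FN p : F (- p) = - F p by rewrite /F !cosintN !sinintN//; ring.
rewrite -big_split/= -[RHS]addr0 -[X in _ = _ + X](zenum_sum_odd M FN) -big_split/=.
apply: eq_bigr => k _.
have -> : reint A B (zenum k) = cosint A (zenum k) - sinint B (zenum k).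
  by rewrite /reint RintegralB//; apply: sqint_mul => //;
    [exact: sqint_cos|exact: sqint_sin].
have -> : imint A B (zenum k) = sinint A (zenum k) + cosint B (zenum k).
  by rewrite /imint RintegralD//; apply: sqint_mul => //;
    [exact: sqint_sin|exact: sqint_cos].
by rewrite /F; ring.
Qed.

Lemma complex_bessel A B M : sqint mu I A -> sqint mu I B ->
  \sum_(k < M.*2.+1) (reint A B (zenum k) ^+ 2 + imint A B (zenum k) ^+ 2) <=
  T * (ip mu I A A + ip mu I B B).
Proof.
move=> sA sB; rewrite complex_energyE// mulrDr.
have H h : sqint mu I h ->
    \sum_(k < M.*2.+1) ip mu I h (cas_basis T k) ^+ 2 <= T * ip mu I h h.
  move=> sh; have := cas_defect_ge0 T0 M.*2.+1 sh.
  by rewrite /cas_defect /defect subr_ge0 ler_pdivrMr// mulrC.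
by rewrite lerD// H.
Qed.

(** Valid for every large M, so that finitely many functions can share one truncation. *)
Lemma complex_parseval (A B : R -> R) (e : R) : sqint mu I A -> sqint mu I B -> 0 < e ->
  exists M0, forall M, (M0 <= M)%N -> T * (ip mu I A A + ip mu I B B) - e <=
  \sum_(k < M.*2.+1) (reint A B (zenum k) ^+ 2 + imint A B (zenum k) ^+ 2).
Proof.
move=> sA sB e0.
have H (h : R -> R) : sqint mu I h -> exists M0, forall M, (M0 <= M)%N ->
    T * ip mu I h h - e / 2 <= \sum_(k < M.*2.+1) ip mu I h (cas_basis T k) ^+ 2.
  move=> sh; have [_ gh] := fourier_good_sqint T0 sh.
  have e2 : 0 < e / 2 / T by rewrite !divr_gt0.
  have [M0 HM] := gh _ e2.
  exists M0 => M M0M.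
  have : cas_defect T M.*2.+1 h <= e / 2 / T.
    apply: le_trans HM; apply: cas_defect_mono => //.
    by rewrite (leq_trans M0M)// -addnn leqW// leq_addr.
  rewrite /cas_defect /defect ler_pdivlMr// mulrBl divfK ?gt_eqF//; lra.
have [M1 H1] := H A sA; have [M2 H2] := H B sB.
exists (maxn M1 M2) => M; rewrite geq_max => /andP[h1 h2].
rewrite complex_energyE//; have := H1 M h1; have := H2 M h2; lra.
Qed.

End Energy.

(** * Translation and folding of integrals *)

Section Shift.
Variable R : realType.
Local Notation mu := (@lebesgue_measure R).

(** Named, and typed on [measurableTypeR R], so that it can carry the structure of a measurable
    function. *)
Definition shiftR (c : R) : measurableTypeR R -> measurableTypeR R := fun x => x + c.

Lemma measurable_shift (c : R) : measurable_fun [set: measurableTypeR R] (shiftR c).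
Proof. by apply: measurable_funD. Qed.

HB.instance Definition _ (c : R) :=
  isMeasurableFun.Build _ _ _ _ (shiftR c) (measurable_shift c).

Lemma lebesgue_measure_shift (c : R) (A : set R) : measurable A ->
  pushforward mu (shiftR c) A = mu A.
Proof.
move=> mA; apply/esym/lebesgue_measure_unique => //= _ [[x y] _ <-] /=.
rewrite /pushforward.
have -> : shiftR c @^-1` `]x, y]%classic = `]x - c, y - c]%classic.
  by apply/seteqP; split => z /=; rewrite /shiftR !in_itv/= ltrBlDr lerBrDr.
rewrite !lebesgue_measure_itv/= !lte_fin ltrD2r; case: ifP => // _.
by rewrite -!EFinB opprB addrA subrK.
Qed.

Lemma preimage_shift_itvco (a b c : R) :
  shiftR c @^-1` `[a + c, b + c[%classic = `[a, b[%classic.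
Proof. by apply/seteqP; split => z /=; rewrite /shiftR !in_itv/= lerD2r ltrD2r. Qed.

Lemma ge0_integral_shift (f : R -> \bar R) (a b c : R) :
  measurable_fun [set: R] f -> (forall x, (0 <= f x)%E) ->
  (\int[mu]_(x in `[a, b[) f (x + c)%R = \int[mu]_(x in `[(a + c)%R, (b + c)%R[) f x)%E.
Proof.
move=> mf f0.
have := @ge0_integral_pushforward _ _ (measurableTypeR R) (measurableTypeR R) R _ (measurable_shift c) mu
  `[a + c, b + c[%classic f.
rewrite preimage_shift_itvco => <- //; last exact: measurable_funTS.
by apply: eq_measure_integral => A mA _; exact: (lebesgue_measure_shift c mA).
Qed.

Lemma integrable_shift (f : R -> R) (a b c : R) :
  measurable_fun [set: R] f -> mu.-integrable `[a + c, b + c[ (EFin \o f) ->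
  mu.-integrable `[a, b[ (EFin \o (fun x => f (x + c))).
Proof.
move=> mf /integrableP[_ fi]; apply/integrableP; split.
  apply/measurable_EFinP/measurable_funTS.
  by apply: (measurableT_comp mf); exact: measurable_shift.
rewrite (@ge0_integral_shift (fun x => `|(f x)%:E|%E))//.
by apply: measurableT_comp => //; exact/measurable_EFinP.
Qed.

Lemma Rintegral_shift (f : R -> R) (a b c : R) :
  measurable_fun [set: R] f -> mu.-integrable `[a + c, b + c[ (EFin \o f) ->
  \int[mu]_(x in `[a, b[) f (x + c) = \int[mu]_(x in `[a + c, b + c[) f x.
Proof.
move=> mf fi; have fi' := integrable_shift mf fi.
rewrite /Rintegral; congr fine.
have := @integral_pushforward _ _ (measurableTypeR R) (measurableTypeR R) R _ (measurable_shift c) mu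
  `[a + c, b + c[%classic (EFin \o f).
rewrite preimage_shift_itvco => <- //; last exact/measurable_EFinP.
by apply: eq_measure_integral => A mA _; exact: (lebesgue_measure_shift c mA).
Qed.

(** The induction splits off the last cell and translates it back to [0, T[; measurability on the
    whole line passes to all translates. *)
Lemma Rintegral_fold (f : R -> R) (T : R) (n : nat) : 0 < T ->
  measurable_fun [set: R] f -> mu.-integrable `[0, n%:R * T[ (EFin \o f) ->
  (forall j : 'I_n, mu.-integrable `[0, T[ (EFin \o (fun s => f (s + j%:R * T)))) /\
  \int[mu]_(x in `[0, n%:R * T[) f x =
  \sum_(j < n) \int[mu]_(s in `[0, T[) f (s + j%:R * T).
Proof.
move=> T0 mf; elim: n => [_|n IH].
  split; first by case.
  by rewrite big_ord0 mul0r set_itv_ge ?Rintegral_set0// bnd_simp ltxx.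
have nT : n%:R * T <= n.+1%:R * T by rewrite ler_pM2r// ler_nat.
have n0 : 0 <= n%:R * T by rewrite mulr_ge0// ltW.
have E : `[0, n.+1%:R * T[%classic = `[0, n%:R * T[%classic `|` `[n%:R * T, n.+1%:R * T[%classic :> set R.
  by rewrite -itv_bndbnd_setU// bnd_simp.
rewrite {1 2}E => fi.
have fi1 : mu.-integrable `[0, n%:R * T[ (EFin \o f).
  by apply: integrableS fi => //; exact: measurableU.
have fi2 : mu.-integrable `[0 + n%:R * T, T + n%:R * T[ (EFin \o f).
  rewrite add0r (_ : T + n%:R * T = n.+1%:R * T); last by rewrite -natr1; ring.
  by apply: integrableS fi => //; exact: measurableU.
have [IH1 IH2] := IH fi1; split.
  move=> j; have [jn|jn] := ltnP j n; first exact: (IH1 (Ordinal jn)).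
  have -> : (j : nat) = n by apply/eqP; rewrite eqn_leq jn -ltnS ltn_ord.
  exact: integrable_shift.
rewrite Rintegral_setU//; last first.
  apply/disj_setPS => x [] /=; rewrite !in_itv/= => /andP[_ h1] /andP[h2 _].
  by move: (le_lt_trans h2 h1); rewrite ltxx.
rewrite IH2 big_ord_recr/= Rintegral_shift// add0r.
by rewrite (_ : T + n%:R * T = n.+1%:R * T)//; rewrite -natr1; ring.
Qed.

End Shift.

Section Rotation.
Variable R : realType.

Lemma cosD_int2pi (x : R) (p : int) : cos (x + p%:~R * (2 * pi)) = cos x.
Proof. by rewrite cosD cos_int2pi sin_int2pi mulr1 mulr0 subr0. Qed.

Lemma sinD_int2pi (x : R) (p : int) : sin (x + p%:~R * (2 * pi)) = sin x.
Proof. by rewrite sinD cos_int2pi sin_int2pi mulr1 mulr0 addr0. Qed.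

Lemma rotation_norm (x y t : R) :
  (x * cos t - y * sin t) ^+ 2 + (x * sin t + y * cos t) ^+ 2 = x ^+ 2 + y ^+ 2.
Proof.
have -> : (x * cos t - y * sin t) ^+ 2 + (x * sin t + y * cos t) ^+ 2 =
  (x ^+ 2 + y ^+ 2) * (cos t ^+ 2 + sin t ^+ 2) by ring.
by rewrite cos2Dsin2 mulr1.
Qed.

End Rotation.

(** * Fourier integrals over [0, 2pi[ *)

Section FourierIntegral.
Variable R : realType.
Local Notation mu := (@lebesgue_measure R).
Local Notation I := (`[0, 2 * pi[%classic : set R).
Implicit Types a b : R -> R.

Let p0 : 0 < 2 * pi :> R.
Proof. by rewrite mulr_gt0// pi_gt0. Qed.

Definition fre a b (x : R) : R := \int[mu]_(t in I) (a t * cos (x * t) - b t * sin (x * t)).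
Definition fim a b (x : R) : R := \int[mu]_(t in I) (a t * sin (x * t) + b t * cos (x * t)).

(** Real part of the modulated density (a + i b) e^{i x t}; [rotim] is the imaginary part. *)
Definition rotre a b (x t : R) : R := a t * cos (x * t) - b t * sin (x * t).
Definition rotim a b (x t : R) : R := a t * sin (x * t) + b t * cos (x * t).

Lemma sqint_mul_cos (D : set R) a x c : measurable D -> sqint mu D a ->
  sqint mu D (fun t => a t * cos (x * t + c)).
Proof.
move=> mD sa; apply: (@sqint_mul_bounded _ _ _ _ _ _ _ 1) => //.
- exact: measurable_cos_affine.
- by move=> t _; exact: cos_max.
Qed.

Lemma sqint_mul_sin (D : set R) a x c : measurable D -> sqint mu D a ->
  sqint mu D (fun t => a t * sin (x * t + c)).
Proof.
move=> mD sa; apply: (@sqint_mul_bounded _ _ _ _ _ _ _ 1) => //.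
- exact: measurable_sin_affine.
- by move=> t _; exact: sin_max.
Qed.

Lemma sqint_rotre (D : set R) a b x : measurable D -> sqint mu D a -> sqint mu D b ->
  sqint mu D (rotre a b x).
Proof.
move=> mD sa sb.
have := sqintB (mu := mu) mD (sqint_mul_cos x 0 mD sa) (sqint_mul_sin x 0 mD sb).
by under eq_fun do rewrite addr0.
Qed.

Lemma sqint_rotim (D : set R) a b x : measurable D -> sqint mu D a -> sqint mu D b ->
  sqint mu D (rotim a b x).
Proof.
move=> mD sa sb.
have := sqintD (mu := mu) mD (sqint_mul_sin x 0 mD sa) (sqint_mul_cos x 0 mD sb).
by under eq_fun do rewrite addr0.
Qed.

Lemma sqint_integrable (T : R) a : sqint mu `[0, T[ a ->
  mu.-integrable `[0, T[ (EFin \o a).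
Proof.
move=> sa; have h : sqint mu `[0, T[ (fun=> 1).
  apply: (@sqint_bounded _ _ _ _ _ _ 1) => //; first exact: lebesgue_itvco_fin.
  by move=> x _; rewrite normr1.
have := sqint_mul (D := `[0, T[%classic) (mu := mu) _ sa h.
by under [X in EFin \o X]eq_fun do rewrite mulr1; apply.
Qed.

Lemma ip_addE (D : set R) a b : measurable D -> sqint mu D a -> sqint mu D b ->
  ip mu D a a + ip mu D b b = \int[mu]_(t in D) (a t ^+ 2 + b t ^+ 2).
Proof.
move=> mD [_ a2] [_ b2]; rewrite RintegralD//; congr (_ + _);
by apply: eq_Rintegral => t _; rewrite expr2.
Qed.

Lemma ip_rot (D : set R) a b x : measurable D -> sqint mu D a -> sqint mu D b ->
  ip mu D (rotre a b x) (rotre a b x) + ip mu D (rotim a b x) (rotim a b x) =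
  ip mu D a a + ip mu D b b.
Proof.
move=> mD sa sb; rewrite ip_addE//; [|exact: sqint_rotre|exact: sqint_rotim].
rewrite ip_addE//; apply: eq_Rintegral => t _; exact: rotation_norm.
Qed.

(** Modulation turns the values f(x + p), for fixed x, into the Fourier coefficients of one function
    on [0, 2 pi[, to which Bessel's inequality applies. *)
Lemma fre_reint a b x p : fre a b (x + p%:~R) =
  reint (2 * pi) (rotre a b x) (rotim a b x) p.
Proof.
apply: eq_Rintegral => t _; rewrite divff ?gt_eqF// mulr1 mulrDl cosD sinD.
by rewrite /rotre /rotim; ring.
Qed.

Lemma fim_imint a b x p : fim a b (x + p%:~R) =
  imint (2 * pi) (rotre a b x) (rotim a b x) p.
Proof.
apply: eq_Rintegral => t _; rewrite divff ?gt_eqF// mulr1 mulrDl cosD sinD.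
by rewrite /rotre /rotim; ring.
Qed.

(** Continuity is wanted for the measurability of |f|^2 on the line. *)
Lemma fourier_integral_continuous a b (F : R -> R -> R) :
  sqint mu I a -> sqint mu I b ->
  (forall x, mu.-integrable I (EFin \o F x)) ->
  (forall t, continuous (F ^~ t)) ->
  (forall x t, `|F x t| <= `|a t| + `|b t|) ->
  continuous (fun x => \int[mu]_(t in I) F x t).
Proof.
move=> sa sb iF cF Fb x.
have mI : @measurable _ (measurableTypeR R) I by [].
have ig : mu.-integrable I (EFin \o (fun t => `|a t| + `|b t|)).
  have h1 := integrable_norm (sqint_integrable sa).
  have h2 := integrable_norm (sqint_integrable sb).
  have := integrableD mI h1 h2.
  by apply: eq_integrable => // t _ /=; rewrite -EFinD.
apply: (@continuity_under_integral _ _ _ mu F I mI (x - 1) (x + 1)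
  _ _ (fun t => `|a t| + `|b t|)) => //.
- by apply: aeW => t _ z _; exact: cF.
- by move=> z _; apply: aeW => t _; exact: Fb.
- by rewrite inE/= in_itv/=; apply/andP; split; lra.
Qed.

Lemma continuous_scale_cos (c t : R) : continuous (fun x : R => c * cos (x * t)).
Proof.
move=> x; apply: cvgM; first exact: cvg_cst.
apply: (@continuous_comp _ _ _ (fun y : R => y * t) cos).
  exact: mulrr_continuous.
exact: continuous_cos.
Qed.

Lemma continuous_scale_sin (c t : R) : continuous (fun x : R => c * sin (x * t)).
Proof.
move=> x; apply: cvgM; first exact: cvg_cst.
apply: (@continuous_comp _ _ _ (fun y : R => y * t) sin).
  exact: mulrr_continuous.
exact: continuous_sin.
Qed.

Lemma continuous_fre a b : sqint mu I a -> sqint mu I b -> continuous (fre a b).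
Proof.
move=> sa sb; apply: (fourier_integral_continuous sa sb).
- move=> x; apply: sqint_integrable; exact: sqint_rotre.
- by move=> t x; apply: cvgB; [exact: continuous_scale_cos|exact: continuous_scale_sin].
- move=> x t; apply: (le_trans (ler_normB _ _)); rewrite !normrM.
  by rewrite lerD// -[leRHS]mulr1 ler_wpM2l// ?cos_max ?sin_max.
Qed.

Lemma continuous_fim a b : sqint mu I a -> sqint mu I b -> continuous (fim a b).
Proof.
move=> sa sb; apply: (fourier_integral_continuous sa sb).
- move=> x; apply: sqint_integrable; exact: sqint_rotim.
- by move=> t x; apply: cvgD; [exact: continuous_scale_sin|exact: continuous_scale_cos].
- move=> x t; apply: (le_trans (ler_normD _ _)); rewrite !normrM.
  by rewrite lerD// -[leRHS]mulr1 ler_wpM2l// ?cos_max ?sin_max.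
Qed.

Lemma fourier_integral_norm_le a b : sqint mu I a -> sqint mu I b ->
  (\int[mu]_(x in [set: R]) (fre a b x ^+ 2 + fim a b x ^+ 2)%:E <=
   (2 * pi * (ip mu I a a + ip mu I b b))%:E)%E.
Proof.
move=> sa sb; set B := 2 * pi * _.
pose G x := fre a b x ^+ 2 + fim a b x ^+ 2.
have G0 x : (0 <= (G x)%:E)%E by rewrite lee_fin addr_ge0 ?sqr_ge0.
have mG : measurable_fun [set: R] G.
  apply: measurable_funD; apply: measurable_funX; apply: continuous_measurable_fun.
    exact: continuous_fre.
  exact: continuous_fim.
have mGE : measurable_fun [set: R] (EFin \o G) by exact/measurable_EFinP.
(* Unit intervals [p, p + 1[, listed in the order of [zenum] to fit the truncations of
   [complex_bessel]. *)
pose F k : set R := `[0 + (zenum k)%:~R, 1 + (zenum k)%:~R[%classic.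
have FE k x : F k x -> zenum k = Num.floor x.
  rewrite /F /= in_itv/= add0r => /andP[h1 h2]; apply/esym/eqP.
  by rewrite floor_eq h1 intrD addrC.
have cover : [set: R] = \bigcup_k F k.
  apply/esym/seteqP; split => // x _; have [k kx] := zenum_surj (Num.floor x).
  exists k => //; rewrite /F /= kx in_itv/= add0r ge_floor/=.
  by rewrite addrC -[X in _ + X]/(1%:~R) -intrD floorD1_gt.
have tF : trivIset setT F.
  by apply/trivIsetP => i j _ _ ij; apply/seteqP; split => // x [] /FE h1 /FE h2;
    move: ij; rewrite (zenum_inj (etrans h1 (esym h2))) eqxx.
have mI1 : @measurable _ (measurableTypeR R) `[0%R, 1%R[%classic by [].
have mGk k : measurable_fun (`[0%R, 1%R[%classic : set (measurableTypeR R))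
    (fun x => (G (x + (zenum k)%:~R)%R)%:E).
  apply/measurable_EFinP/measurable_funTS.
  by apply: (measurableT_comp mG); exact: measurable_shift.
have intE : (\int[mu]_(x in [set: R]) (G x)%:E =
    \int[mu]_(x in `[0%R, 1%R[) \sum_(k <oo) (G (x + (zenum k)%:~R)%R)%:E)%E.
  have sw := @integral_nneseries _ (measurableTypeR R) R mu _ mI1
    (fun k x => (G (x + (zenum k)%:~R)%R)%:E) mGk (fun k x _ => G0 _).
  have mF k : @measurable _ (measurableTypeR R) (F k) by exact: measurable_itv.
  have bc := @ge0_integral_bigcup _ (measurableTypeR R) R mu F (EFin \o G) mF
    (measurable_funTS mGE) (fun x _ => G0 x) tF.
  apply: (etrans (congr1 (fun D : set R => \int[mu]_(x in D) (G x)%:E)%E cover)).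
  apply: (etrans bc); apply: etrans (esym sw).
  apply: eq_eseriesr => k _; apply: esym.
  exact: (@ge0_integral_shift R (EFin \o G) 0 1 (zenum k)%:~R mGE G0).
rewrite intE.
have bound x : (\sum_(k <oo) (G (x + (zenum k)%:~R)%R)%:E <= B%:E)%E.
  apply: lime_le; first by apply: is_cvg_nneseries.
  apply: nearW => M.
  (* A partial sum of any length is enlarged to one of odd length. *)
  apply: (@le_trans _ _ (\sum_(0 <= k < M.*2.+1) (G (x + (zenum k)%:~R)%R)%:E)%E).
    by apply: lee_sum_nneg_natr => //; rewrite leqW// -addnn leq_addr.
  rewrite big_mkord sumEFin lee_fin /B -(@ip_rot I a b x)//.
  apply: le_trans (complex_bessel p0 M (sqint_rotre x _ sa sb) (sqint_rotim x _ sa sb)) => //.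
  rewrite le_eqVlt; apply/orP; left; apply/eqP; apply: eq_bigr => k _.
  by rewrite /G fre_reint fim_imint.
have mS : measurable_fun (`[0%R, 1%R[%classic : set (measurableTypeR R))
    (fun x => \sum_(k <oo) (G (x + (zenum k)%:~R)%R)%:E)%E.
  have := @ge0_emeasurable_sum _ (measurableTypeR R) R `[0%R, 1%R[%classic
    (fun k x => (G (x + (zenum k)%:~R)%R)%:E) xpredT (fun k x _ _ => G0 _) (fun k _ => mGk k).
  exact.
have S0 (x : R) : (0 <= \sum_(k <oo) (G (x + (zenum k)%:~R)%R)%:E)%E.
  by apply: nneseries_ge0 => k _ _; exact: G0.
apply: (@le_trans _ _ (\int[mu]_(x in `[0%R, 1%R[) (cst B%:E) x)%E).
  apply: (@ge0_le_integral _ (measurableTypeR R) R mu _ mI1) => //.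
have mu1 : mu `[0%R, 1%R[%classic = 1%E.
  by rewrite lebesgue_measure_itv/= lte_fin ltr01 oppr0 adde0.
rewrite integral_cst//; apply: (@le_trans _ _ (B%:E * 1)%E); last by rewrite mule1.
rewrite le_eqVlt; apply/orP; left; apply/eqP.
exact: (congr1 (fun z => B%:E * z)%E mu1).
Qed.

End FourierIntegral.

(** * Lower sampling bound *)

Section SamplingLower.
Variable R : realType.
Local Notation mu := (@lebesgue_measure R).
Variables (n : nat) (a b : R -> R).
Hypothesis n0 : (0 < n)%N.
Hypothesis ma : measurable_fun [set: R] a.
Hypothesis mb : measurable_fun [set: R] b.
Let T : R := 2 * pi / n%:R.
Local Notation I := (`[0, T[%classic : set R).
Local Notation I2 := (`[0, 2 * pi[%classic : set R).
Hypothesis sa : sqint mu I2 a.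
Hypothesis sb : sqint mu I2 b.

Lemma Rintegral_sum (D : set R) (m : nat) (f : 'I_m -> R -> R) : measurable D ->
  (forall i, mu.-integrable D (EFin \o f i)) ->
  \int[mu]_(t in D) (\sum_i f i t) = \sum_i \int[mu]_(t in D) f i t.
Proof.
move=> mD fi.
have H r : mu.-integrable D (EFin \o (fun t => \sum_(i <- r) f i t)) /\
    \int[mu]_(t in D) (\sum_(i <- r) f i t) = \sum_(i <- r) \int[mu]_(t in D) f i t.
  elim: r => [|i r [IH1 IH2]].
    split; first by under [X in EFin \o X]eq_fun do rewrite big_nil; exact: (integrable0 mu D).
    by under eq_Rintegral do rewrite big_nil; rewrite big_nil Rintegral_cst// mul0r.
  split.
    have := @integrableD _ _ _ mu D mD _ _ (fi i) IH1.
    by apply: eq_integrable => // t _ /=; rewrite big_cons -EFinD.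
  under eq_Rintegral do rewrite big_cons.
  by rewrite RintegralD// IH2 big_cons.
by case: (H (index_enum _)).
Qed.

Let nR : n%:R != 0 :> R.
Proof. by rewrite pnatr_eq0 -lt0n. Qed.

Let T0 : 0 < T.
Proof. by rewrite divr_gt0 ?ltr0n// mulr_gt0// pi_gt0. Qed.

Let nT : n%:R * T = 2 * pi.
Proof. by rewrite /T mulrC divfK. Qed.

Let wE : 2 * pi / T = n%:R.
Proof. by rewrite -nT mulfK// gt_eqF. Qed.

Lemma sqint_fold (h : R -> R) (j : 'I_n) : measurable_fun [set: R] h ->
  sqint mu I2 h -> sqint mu I (fun s => h (s + j%:R * T)).
Proof.
move=> mh [_ h2]; split.
  apply: measurable_funTS; apply: (measurableT_comp mh).
  exact: (@measurable_shift R).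
have mh2 : measurable_fun [set: R] (fun t => h t ^+ 2) by exact: measurable_funX.
have [|hj _] := @Rintegral_fold R _ T n T0 mh2; first by rewrite nT.
exact: hj.
Qed.

Let aj (j : 'I_n) (s : R) := a (s + j%:R * T).
Let bj (j : 'I_n) (s : R) := b (s + j%:R * T).
(** A q + i B q folds g(t) e^{i q t}, with g = a + i b, onto one cell; its p-th Fourier coefficient
    there is f(q + n p). *)
Let A (q : 'I_n) (s : R) := \sum_(j < n) rotre a b q%:R (s + j%:R * T).
Let B (q : 'I_n) (s : R) := \sum_(j < n) rotim a b q%:R (s + j%:R * T).

Lemma measurable_rotre x : measurable_fun [set: R] (rotre a b x).
Proof.
by apply: measurable_funB; apply: measurable_funM => //;
  [exact: measurable_cosM|exact: measurable_sinM].
Qed.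

Lemma measurable_rotim x : measurable_fun [set: R] (rotim a b x).
Proof.
by apply: measurable_funD; apply: measurable_funM => //;
  [exact: measurable_sinM|exact: measurable_cosM].
Qed.

Let sA q : sqint mu I (A q).
Proof.
apply: sqint_sum => // j; apply: sqint_fold; first exact: measurable_rotre.
exact: sqint_rotre.
Qed.

Let sB q : sqint mu I (B q).
Proof.
apply: sqint_sum => // j; apply: sqint_fold; first exact: measurable_rotim.
exact: sqint_rotim.
Qed.

Lemma Rintegral_foldE (h : R -> R) : measurable_fun [set: R] h ->
  mu.-integrable I2 (EFin \o h) ->
  \int[mu]_(t in I2) h t = \int[mu]_(s in I) \sum_(j < n) h (s + j%:R * T).
Proof.
move=> mh ih; have [|hi] := @Rintegral_fold R _ T n T0 mh; first by rewrite nT.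
by rewrite nT => ->; rewrite Rintegral_sum.
Qed.

(** Since n * T = 2 * pi, the cross term n * p * j * T is a multiple of 2 * pi; this is what permits
    the folding. *)
Lemma sample_angle (q : 'I_n) (p : int) (s : R) (j : 'I_n) :
  (q%:R + n%:R * p%:~R) * (s + j%:R * T) =
  (q%:R * (s + j%:R * T) + p%:~R * (2 * pi / T) * s) + (p * j%:Z)%:~R * (2 * pi).
Proof. by rewrite intrM wE -nT -[j%:~R]/(j%:R); ring. Qed.

Lemma fre_sample (q : 'I_n) (p : int) :
  fre a b (q%:R + n%:R * p%:~R) = reint T (A q) (B q) p.
Proof.
rewrite /fre (Rintegral_foldE (measurable_rotre _)); last first.
  by apply: sqint_integrable; exact: sqint_rotre.
apply: eq_Rintegral => s _; rewrite /A /B !mulr_suml -sumrB.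
apply: eq_bigr => j _; rewrite /rotre /rotim sample_angle.
by rewrite cosD_int2pi sinD_int2pi cosD sinD; ring.
Qed.

Lemma fim_sample (q : 'I_n) (p : int) :
  fim a b (q%:R + n%:R * p%:~R) = imint T (A q) (B q) p.
Proof.
rewrite /fim (Rintegral_foldE (measurable_rotim _)); last first.
  by apply: sqint_integrable; exact: sqint_rotim.
apply: eq_Rintegral => s _; rewrite /A /B !mulr_suml -big_split/=.
apply: eq_bigr => j _; rewrite /rotre /rotim sample_angle.
by rewrite cosD_int2pi sinD_int2pi cosD sinD; ring.
Qed.

Variables (K J : {set 'I_n}) (kappa : R).
Hypothesis supp : forall (j : 'I_n) s, j \notin K -> I s ->
  a (s + j%:R * T) = 0 /\ b (s + j%:R * T) = 0.
Hypothesis frame : forall x y : 'I_n -> R, (forall j, j \notin K -> x j = 0 /\ y j = 0) ->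
  let t (q j : 'I_n) := q%:R * (j%:R * (2 * pi / n%:R)) : R in
  kappa * \sum_j (x j ^+ 2 + y j ^+ 2) <=
  \sum_(q in J) ((\sum_j (x j * cos (t q j) - y j * sin (t q j))) ^+ 2 +
                 (\sum_j (x j * sin (t q j) + y j * cos (t q j))) ^+ 2).

(** The frame inequality for the vector of values g(s + j T); the phase e^{i q s}, common to all j,
    does not change the modulus. *)
Let frame_pointwise s : I s -> kappa * \sum_j (aj j s ^+ 2 + bj j s ^+ 2) <=
  \sum_(q in J) (A q s ^+ 2 + B q s ^+ 2).
Proof.
move=> Is; have := frame (x := aj ^~ s) (y := bj ^~ s) (fun j jK => supp jK Is).
move=> /= h; apply: (le_trans h); rewrite le_eqVlt; apply/orP; left; apply/eqP.
apply: eq_bigr => q _; rewrite -/T.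
set X := \sum_j _; set Y := \sum_j (_ + _).
have -> : A q s = X * cos (q%:R * s) - Y * sin (q%:R * s).
  rewrite /A /X /Y !mulr_suml -sumrB; apply: eq_bigr => j _.
  by rewrite /rotre mulrDr cosD sinD /aj /bj; ring.
have -> : B q s = X * sin (q%:R * s) + Y * cos (q%:R * s).
  rewrite /B /X /Y !mulr_suml -big_split/=; apply: eq_bigr => j _.
  by rewrite /rotim mulrDr cosD sinD /aj /bj; ring.
by rewrite rotation_norm.
Qed.

Lemma frame_integrated : kappa * (ip mu I2 a a + ip mu I2 b b) <=
  \sum_(q in J) (ip mu I (A q) (A q) + ip mu I (B q) (B q)).
Proof.
have mI : @measurable _ (measurableTypeR R) I by [].
have iab : mu.-integrable I2 (EFin \o (fun t => a t ^+ 2 + b t ^+ 2)).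
  have := @integrableD _ _ _ mu I2 _ _ _ sa.2 sb.2.
  by move=> /(_ ltac:(by [])); apply: eq_integrable => // t _ /=; rewrite -EFinD.
have mab : measurable_fun [set: R] (fun t => a t ^+ 2 + b t ^+ 2).
  by apply: measurable_funD; exact: measurable_funX.
rewrite ip_addE// (Rintegral_foldE mab iab).
have ij j : mu.-integrable I (EFin \o (fun s => aj j s ^+ 2 + bj j s ^+ 2)).
  have [_ h1] := sqint_fold j ma sa; have [_ h2] := sqint_fold j mb sb.
  have := @integrableD _ _ _ mu I mI _ _ h1 h2.
  by apply: eq_integrable => // t _ /=; rewrite -EFinD.
have iq q : mu.-integrable I (EFin \o (fun s => A q s ^+ 2 + B q s ^+ 2)).
  have [_ h1] := sA q; have [_ h2] := sB q.
  have := @integrableD _ _ _ mu I mI _ _ h1 h2.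
  by apply: eq_integrable => // t _ /=; rewrite -EFinD.
have isum (m : nat) (f : 'I_m -> R -> R) (P : pred 'I_m) :
    (forall i, mu.-integrable I (EFin \o f i)) ->
    mu.-integrable I (EFin \o (fun s => \sum_(i | P i) f i s)).
  move=> fi; have := @integrable_sum _ _ _ mu I mI _ (index_enum 'I_m) P
    (fun i => EFin \o f i) (fun i _ => fi i).
  by apply: eq_integrable => // t _ /=; rewrite sumEFin.
rewrite -RintegralZl//; last exact: isum.
apply: (@le_trans _ _ (\int[mu]_(s in I) \sum_(q in J) (A q s ^+ 2 + B q s ^+ 2))).
  apply: le_Rintegral => //.
  - have := @integrableZl _ _ _ mu I mI kappa _ (isum n _ predT ij).
    by apply: eq_integrable => // t _ /=; rewrite -EFinM.
  - exact: isum.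
rewrite le_eqVlt; apply/orP; left; apply/eqP.
(* Extension by 0 off J gives a sum over all of ['I_n], the form that [Rintegral_sum] takes. *)
transitivity (\int[mu]_(s in I) \sum_q (if q \in J then A q s ^+ 2 + B q s ^+ 2 else 0)).
  by apply: eq_Rintegral => s _; rewrite big_mkcond.
rewrite Rintegral_sum//; last first.
  move=> q; case: (q \in J); first exact: iq.
  exact: (integrable0 mu I).
rewrite [RHS]big_mkcond/=; apply: eq_bigr => q _; case: (q \in J).
  by rewrite ip_addE.
by rewrite Rintegral_cst// mul0r.
Qed.

Definition sample_set : set int :=
  [set z | exists2 q : 'I_n, q \in J & exists p : int, z = q%:Z + n%:Z * p].

(** Uniqueness of quotient and remainder: each sample occurs once in the sum over rows and
    periods. *)
Lemma sample_inj (q q' : 'I_n) (p p' : int) :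
  q%:Z + n%:Z * p = q'%:Z + n%:Z * p' -> q = q' /\ p = p'.
Proof.
move=> E; have qq : q%:Z = q'%:Z.
  have := congr1 (fun z => (z %% n%:Z)%Z) E.
  by rewrite ![_ + n%:Z * _]addrC ![n%:Z * _]mulrC !modzMDl !modz_small//= ?ltz_nat ?ltn_ord.
split; first by apply: val_inj; case: qq.
move: E; rewrite qq => /addrI /mulfI; apply.
by rewrite eqz_nat -lt0n.
Qed.

Lemma sampling_lower_bound :
  ((kappa * T * (ip mu I2 a a + ip mu I2 b b))%:E <=
  \esum_(l in sample_set) (fre a b l%:~R ^+ 2 + fim a b l%:~R ^+ 2)%:E)%E.
Proof.
apply/lee_addgt0Pr => e e0.
(* Each row may lose e / n, as J has at most n rows. *)
have hM q : exists M0, forall M, (M0 <= M)%N ->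
    T * (ip mu I (A q) (A q) + ip mu I (B q) (B q)) - e / n%:R <=
    \sum_(k < M.*2.+1) (reint T (A q) (B q) (zenum k) ^+ 2 +
                        imint T (A q) (B q) (zenum k) ^+ 2).
  by apply: complex_parseval => //; rewrite divr_gt0// ltr0n.
have [M0 HM0] := choice hM.
pose M := \max_q M0 q.
pose G (l : int) := fre a b l%:~R ^+ 2 + fim a b l%:~R ^+ 2.
pose phi (x : 'I_n * 'I_M.*2.+1) : int := x.1%:Z + n%:Z * zenum x.2.
have phi_inj : injective phi.
  move=> [q k] [q' k'] /sample_inj /= [-> /zenum_inj h].
  by congr pair; apply: val_inj.
pose P (x : 'I_n * 'I_M.*2.+1) := x.1 \in J.
pose s := [seq phi x | x <- enum P].
have us : uniq s by rewrite map_inj_uniq ?enum_uniq.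
have fin : kappa * T * (ip mu I2 a a + ip mu I2 b b) - e <= \sum_(l <- s) G l.
  rewrite /s big_map big_enum/=.
  have -> : \sum_(x in P) G (phi x) = \sum_(q in J) \sum_(k < M.*2.+1)
     (reint T (A q) (B q) (zenum k) ^+ 2 + imint T (A q) (B q) (zenum k) ^+ 2).
    rewrite pair_big_dep/=; apply: eq_big => [x|x _]; first by rewrite andbT.
    rewrite /G /phi -fre_sample -fim_sample.
    by rewrite intrD intrM.
  apply: (@le_trans _ _ (\sum_(q in J)
     (T * (ip mu I (A q) (A q) + ip mu I (B q) (B q)) - e / n%:R))); last first.
    by apply: ler_sum => q _; apply: HM0; exact: leq_bigmax.
  rewrite sumrB -mulr_sumr sumr_const.
  have h1 : T * (kappa * (ip mu I2 a a + ip mu I2 b b)) <=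
    T * \sum_(q in J) (ip mu I (A q) (A q) + ip mu I (B q) (B q)).
    by rewrite ler_pM2l//; exact: frame_integrated.
  have h2 : e / n%:R *+ #|J| <= e.
    rewrite -[_ *+ #|J|]mulr_natr mulrAC ler_pdivrMr ?ltr0n// ler_pM2l// ler_nat.
    by rewrite -[leqRHS]card_ord max_card.
  by rewrite [kappa * T]mulrC -[T * kappa * _]mulrA; exact: lerB.
rewrite -leeBlDr//; apply: esum_ge; exists [set` s].
  split; first exact: finite_seq.
  move=> l /= /mapP[x]; rewrite mem_enum => xJ ->.
  by exists x.1 => //; exists (zenum x.2).
rewrite -fsbig_seq// sumEFin -EFinB lee_fin; exact: fin.
Qed.

End SamplingLower.

(** * Uniform density of a periodic set *)

Section Density.
Variables (R : realType) (n : nat) (J : {set 'I_n}).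
Hypothesis n0 : (0 < n)%N.
Local Notation L := (sample_set J).

Lemma sample_setD (z : int) : (z + n%:Z \in L) = (z \in L).
Proof.
apply/idP/idP; rewrite !inE => -[q qJ [p E]]; exists q => //.
  by exists (p - 1); rewrite mulrBr mulr1 addrA -E addrK.
by exists (p + 1); rewrite mulrDr mulr1 addrA -E.
Qed.

Lemma sample_set_ord (k : 'I_n) : (k%:Z \in L) = (k \in J).
Proof.
apply/idP/idP => [|kJ]; rewrite inE.
  move=> -[q qJ [p E]]; have [-> _] : k = q /\ 0 = p by apply: (sample_inj n0); rewrite mulr0 addr0.
  by [].
by exists k => //; exists 0; rewrite mulr0 addr0.
Qed.

Definition window (z : int) (N : nat) : nat :=
  (\sum_(k < N) nat_of_bool ((z + k%:Z)%R \in L))%N.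

Lemma windowS z N : window z N.+1 = (window z N + ((z + N%:Z)%R \in L))%N.
Proof. by rewrite /window big_ord_recr. Qed.

Lemma windowSl z N : window z N.+1 = ((z \in L) + window (z + 1)%R N)%N.
Proof.
rewrite /window big_ord_recl/= addr0; congr (_ + _)%N; apply: eq_bigr => k _.
by congr (nat_of_bool (_ \in L)); rewrite /bump/= add1n -addrA -PoszD add1n.
Qed.

Lemma windowD z N M : window z (N + M) = (window z N + window (z + N%:Z)%R M)%N.
Proof.
elim: M => [|M IH]; first by rewrite addn0 /window big_ord0 addn0.
by rewrite addnS !windowS IH addnA -addrA PoszD.
Qed.

(** Sliding by one loses z and gains z + n, which belong to the set together or not at all. *)
Lemma window_period_step z : window (z + 1) n = window z n.
Proof.
have := windowSl z n; rewrite windowS sample_setD addnC => /eqP.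
by rewrite eqn_add2l => /eqP.
Qed.

Lemma window_period z : window z n = #|J|.
Proof.
have w0 : window 0 n = #|J|.
  rewrite /window -sum1_card [RHS]big_mkcond/=; apply: eq_bigr => k _.
  by rewrite add0r sample_set_ord; case: (_ \in _).
rewrite -w0; case: z => m.
  elim: m => [//|m IH]; rewrite -IH -(window_period_step m%:Z).
  by congr window; rewrite -addn1 PoszD.
elim: m => [|m IH]; first by rewrite -(window_period_step (Negz 0)).
rewrite -IH -(window_period_step (Negz m.+1)); congr window.
by rewrite !NegzE -[m.+2]addn1 PoszD opprD subrK.
Qed.

Lemma window_mul z t : window z (t * n) = (t * #|J|)%N.
Proof.
elim: t z => [|t IH] z; first by rewrite !mul0n /window big_ord0.
by rewrite mulSn windowD window_period IH mulSn.
Qed.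

Lemma window_mono z N M : (N <= M)%N -> (window z N <= window z M)%N.
Proof. by move=> NM; rewrite -(subnKC NM) windowD leq_addr. Qed.

Lemma window_lower z N : (N %/ n * #|J| <= window z N)%N.
Proof. by rewrite -(window_mul z) window_mono// leq_trunc_div. Qed.

Lemma window_upper z N : (window z N <= (N %/ n).+1 * #|J|)%N.
Proof. by rewrite -(window_mul z) window_mono// ltnW// ltn_ceil. Qed.

(** As ceil x < x + 1, every candidate ceil x + k with k < trunc r lies in [x, x + r]; the test can
    reject only the last two. *)
Lemma count_in_window (x r : R) : 0 <= r ->
  (window (Num.ceil x) (Num.truncn r) <= count_in L x r <=
   window (Num.ceil x) (Num.truncn r).+2)%N.
Proof.
move=> r0; have /andP[c1 c2] := real_ceil_itv (num_real x).
have /andP[t1 t2] := truncn_itv r0.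
rewrite /count_in /window; apply/andP; split; last first.
  by apply: leq_sum => k _; case: (_ <= _).
rewrite [leqRHS]big_ord_recr/= [X in (_ <= X + _)%N]big_ord_recr/= -addnA.
apply: leq_trans (leq_addr _ _); apply: leq_sum => k _.
rewrite (_ : _ <= _ = true)//; rewrite intrD.
have : k.+1%:R <= (Num.truncn r)%:R :> R by rewrite ler_nat.
move: c1; rewrite intrB -natr1 -[k%:~R]/(k%:R : R); lra.
Qed.

(** n pays for an incomplete period and 2 for the ends, the density being at most 1. The error is
    uniform in x, so it passes to the infimum and the supremum. *)
Lemma count_in_dist (x r : R) : 0 < r ->
  `|(count_in L x r)%:R - r * (#|J|%:R / n%:R)| <= n%:R + 2 :> R.
Proof.
move=> r0; have /andP[h1 h2] := count_in_window x (ltW r0).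
have /andP[t1 t2] := truncn_itv (ltW r0).
set N := Num.truncn r in h1 h2 t1 t2.
have nR : 0 < n%:R :> R by rewrite ltr0n.
have Jn : #|J|%:R <= n%:R :> R.
  by rewrite ler_nat -[leqRHS]card_ord max_card.
pose D : R := #|J|%:R / n%:R.
have D0 : 0 <= D by rewrite divr_ge0.
have D1 : D <= 1 by rewrite ler_pdivrMr// mul1r.
have DJ : #|J|%:R = n%:R * D by rewrite /D mulrC divfK// gt_eqF.
have lo : (N %/ n)%:R * #|J|%:R <= (count_in L x r)%:R :> R.
  by rewrite -natrM ler_nat; exact: leq_trans (window_lower _ _) h1.
have hi : (count_in L x r)%:R <= (N.+2 %/ n).+1%:R * #|J|%:R :> R.
  by rewrite -natrM ler_nat; exact: leq_trans h2 (window_upper _ _).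
have q1 : N%:R <= (N %/ n)%:R * n%:R + n%:R :> R.
  by rewrite -natrM -natrD ler_nat -mulSnr ltnW// ltn_ceil.
have q2 : (N.+2 %/ n)%:R * n%:R <= N%:R + 2 :> R.
  by rewrite -natrM -natrD ler_nat addn2 leq_trunc_div.
have m1 : N%:R * D <= ((N %/ n)%:R * n%:R + n%:R) * D by rewrite ler_wpM2r.
have m2 : (N.+2 %/ n)%:R * n%:R * D <= (N%:R + 2) * D by rewrite ler_wpM2r.
have m3 : r * D <= (N%:R + 1) * D by rewrite ler_wpM2r// natr1 ltW.
have m4 : N%:R * D <= r * D by rewrite ler_wpM2r.
have m5 : n%:R * D <= n%:R by rewrite -[leRHS]mulr1 ler_wpM2l.
rewrite DJ in lo hi; rewrite -natr1 in hi.
by rewrite ler_norml -/D; apply/andP; split; lra.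
Qed.

Lemma cvg_ratio_pinfty (g : R -> R) (D c : R) :
  (forall r, 0 < r -> `|g r - r * D| <= c) -> g r / r @[r --> +oo] --> D.
Proof.
move=> H; apply/cvgrPdist_le => e e0; near=> r.
have r0 : 0 < r by near: r; apply: nbhs_pinfty_gt; exact: num_real.
have rc : c / e <= r by near: r; apply: nbhs_pinfty_ge; exact: num_real.
have -> : D - g r / r = - (g r - r * D) / r by field; rewrite gt_eqF.
rewrite normrM normrN normfV (gtr0_norm r0) ler_pdivrMr//.
by apply: (le_trans (H r r0)); rewrite mulrC -ler_pdivrMr.
Unshelve. all: by end_near. Qed.

Lemma sample_set_uniform_density : has_uniform_density L (#|J|%:R / n%:R : R).
Proof.
have ne r : ([set (count_in L x r)%:R | x in [set: R]] : set R) !=set0.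
  by exists (count_in L 0 r)%:R, 0.
split; apply: (@cvg_ratio_pinfty _ _ (n%:R + 2)) => r r0.
  have lb : lbound [set (count_in L x r)%:R | x in [set: R]]
      (r * (#|J|%:R / n%:R) - (n%:R + 2)).
    move=> _ [x _ <-]; have := count_in_dist x r0; rewrite ler_norml => /andP[? _]; lra.
  have h1 := lb_le_inf (ne r) lb.
  have h2 : min_count L r <= (count_in L 0 r)%:R.
    by apply: ge_inf; [exists (r * (#|J|%:R / n%:R) - (n%:R + 2))|exists 0].
  have := count_in_dist 0 r0; rewrite !ler_norml => /andP[_ h3].
  by rewrite /min_count in h2 *; apply/andP; split; lra.
have ub : ubound [set (count_in L x r)%:R | x in [set: R]]
    (r * (#|J|%:R / n%:R) + (n%:R + 2)).
  move=> _ [x _ <-]; have := count_in_dist x r0; rewrite ler_norml => /andP[_ ?]; lra.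
have h1 := ge_sup (ne r) ub.
have h2 : (count_in L 0 r)%:R <= max_count L r.
  by apply: ub_le_sup; [exists (r * (#|J|%:R / n%:R) + (n%:R + 2))|exists 0].
have := count_in_dist 0 r0; rewrite !ler_norml => /andP[h3 _].
by rewrite /max_count in h2 *; apply/andP; split; lra.
Qed.

End Density.

(** * Covering a compact set by grid cells *)

Section Covering.
Variables (R : realType) (S : set R).
Local Notation mu := (@lebesgue_measure R).
Hypothesis cS : compact S.
Hypothesis S2pi : S `<=` `[0, 2 * pi]%classic.
Hypothesis S0 : (0 < mu S)%E.

(** Every point of S has a ball inside U; half its radius serves all nearby points, and compactness
    gives one r for all of S. *)
Lemma compact_tube (U : set R) : open U -> S `<=` U ->
  exists2 r : R, 0 < r & forall x y, S x -> `|x - y| < r -> U y.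
Proof.
move=> oU SU.
have /compact_near_coveringP := cS.
move=> /(_ R (0^'+ : set_system R) (fun r x => forall y, `|x - y| < r -> U y) _) H.
have : \forall r \near 0^'+, S `<=` (fun x => forall y, `|x - y| < r -> U y).
  apply: H => x Sx.
  have [e e0 He] : exists2 e : R, 0 < e & ball x e `<=` U.
    have /nbhs_ballP[e e0 He] := open_nbhs_nbhs (conj oU (SU x Sx)).
    by exists e.
  exists (ball x (e / 2), [set r | r < e / 2]).
    split => /=; first by apply: nbhsx_ballx; rewrite divr_gt0.
    by apply: nbhs_right_lt; rewrite divr_gt0.
  move=> [x' r] /= [hx hr] y xy; apply: He; rewrite /ball/= in hx *.
  rewrite (_ : x - y = (x - x') + (x' - y)); last by rewrite addrA subrK.
  apply: (le_lt_trans (ler_normD _ _)).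
  by rewrite (splitr e) ltrD// (lt_trans xy).
move=> Hn; have [r [r0 Hr]] : exists r : R, 0 < r /\
    S `<=` (fun x => forall y, `|x - y| < r -> U y).
  near (0 : R)^'+ => r; exists r; split; first by near: r; exact: nbhs_right_gt.
  by near: r.
by exists r => // x y Sx; exact: Hr.
Unshelve. all: by end_near. Qed.

(** Outer regularity gives an open U little larger than S; cells shorter than the tube radius that
    meet S stay inside U. Asking for at least N cells makes a later rounding negligible. *)
Lemma grid_cover (eps : R) (N : nat) : 0 < eps ->
  exists (n : nat) (K : {set 'I_n}), [/\ (0 < n)%N, (N <= #|K|)%N,
    fine (mu S) <= #|K|%:R * (2 * pi / n%:R),
    #|K|%:R * (2 * pi / n%:R) <= (1 + eps) * fine (mu S) &
    forall (j : 'I_n) s, j \notin K -> `[0, 2 * pi / n%:R[%classic s ->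
      ~ S (s + j%:R * (2 * pi / n%:R))].
Proof.
move=> e0.
have mS : measurable S by exact: compact_measurable.
have fS : (mu S < +oo)%E by exact: compact_finite_measure.
have muSE : mu S = (fine (mu S))%:E by rewrite fineK// ge0_fin_numE.
set v := fine (mu S) in muSE *.
have v0 : 0 < v by rewrite -lte_fin -muSE.
have p0 : 0 < 2 * pi :> R by rewrite mulr_gt0// pi_gt0.
have [U [oU SU muU]] := lebesgue_regularity_outer mS fS (mulr_gt0 e0 v0).
have mU : measurable U by exact: open_measurable.
have [r r0 Hr] := compact_tube oU SU.
(* The first term forces T < r, the second N * T <= v and hence N <= #|K|. *)
pose n := (Num.truncn (2 * pi / r + N%:R * (2 * pi) / v)).+1.
pose T : R := 2 * pi / n%:R.
have nR : 0 < n%:R :> R by rewrite ltr0n.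
have hn : 2 * pi / r + N%:R * (2 * pi) / v < n%:R by exact: truncnS_gt.
have h1 : 0 < 2 * pi / r by rewrite divr_gt0.
have h2 : 0 <= N%:R * (2 * pi) / v by rewrite divr_ge0 ?(ltW v0)// mulr_ge0 ?(ltW p0).
have Tr : T < r.
  rewrite /T ltr_pdivrMr// [ltRHS]mulrC -ltr_pdivrMr//; lra.
have T0 : 0 < T by rewrite divr_gt0.
have nT : n%:R * T = 2 * pi by rewrite /T mulrC divfK// gt_eqF.
pose cell (j : 'I_n) : set R := `[j%:R * T, j%:R * T + T[%classic.
pose K : {set 'I_n} := [set j : 'I_n | `[< exists2 x, cell j x & S x >] ]%SET.
pose V := \big[setU/set0]_(j < n | j \in K) cell j.
have cellP j x : cell j x -> j%:R <= x / T < j%:R + 1.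
  rewrite /cell/= in_itv/= => /andP[a1 a2].
  rewrite ler_pdivlMr// a1/= ltr_pdivrMr// mulrDl mul1r//.
have tcell : trivIset setT cell.
  apply/trivIsetP => i j _ _ ij; apply/seteqP; split => // x [/cellP hi /cellP hj].
  move/negP: ij; apply; apply/eqP/val_inj/eqP => /=.
  move: hi hj => /andP[i1 i2] /andP[j1 j2].
  have b1 : (i < j.+1)%N by rewrite -(ltr_nat R) -natr1; lra.
  have b2 : (j < i.+1)%N by rewrite -(ltr_nat R) -natr1; lra.
  by rewrite eqn_leq; move: b1 b2; rewrite !ltnS => -> ->.
have mcell j : @measurable _ (measurableTypeR R) (cell j) by exact: measurable_itv.
have mV : @measurable _ (measurableTypeR R) V by exact: bigsetU_measurable.
have mucell j : mu (cell j) = T%:E.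
  by rewrite lebesgue_measure_itv/= lte_fin ltrDl T0 -EFinB addrAC subrr add0r.
have muV : mu V = (#|K|%:R * T)%:E.
  have := @measure_bigsetU_ord _ R (measurableTypeR R) mu n (mem K) cell mcell tcell.
  move=> E; rewrite /V [LHS]E (eq_bigr (fun=> T%:E)) => [|j _]; last exact: mucell.
  by rewrite sumEFin sumr_const -[T *+ _]mulr_natl.
have VP x : V x <-> exists2 j, j \in K & cell j x.
  rewrite /V -bigcup_seq_cond; split.
    by move=> [j /= /andP[_ jK] cj]; exists j.
  by move=> [j jK cj]; exists j => //=; rewrite mem_index_enum.
have VU : V `<=` U.
  move=> y /VP[j]; rewrite inE => /asboolP[x cx Sx] cy; apply: (Hr x) => //.
  move: cx cy; rewrite /cell/= !in_itv/= => /andP[x1 x2] /andP[y1 y2].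
  by apply: lt_trans Tr; rewrite ltr_norml; apply/andP; split; lra.
(* The point 2 * pi belongs to no half-open cell and is discarded as a null set. *)
have SV : S `<=` V `|` [set 2 * pi].
  move=> x Sx; have := S2pi Sx; rewrite /= in_itv/= => /andP[x0].
  rewrite le_eqVlt => /predU1P[->|x2]; [by right|left].
  have xT0 : 0 <= x / T by rewrite divr_ge0// ltW.
  have /andP[t1 t2] := truncn_itv xT0.
  have jn : (Num.truncn (x / T) < n)%N.
    by rewrite -(ltr_nat R); apply: (le_lt_trans t1); rewrite ltr_pdivrMr// nT.
  have cx : cell (Ordinal jn) x.
    rewrite /cell/= in_itv/= -ler_pdivlMr// t1/=.
    by move: t2; rewrite -natr1 ltr_pdivrMr// mulrDl mul1r.
  by apply/VP; exists (Ordinal jn) => //; rewrite inE; apply/asboolP; exists x.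
have muS1 : v <= #|K|%:R * T.
  rewrite -lee_fin -muSE -muV.
  have E : mu (V `|` [set 2 * pi]) = mu V.
    by apply: measureU0 => //; exact: lebesgue_measure_set1.
  rewrite -E; apply: le_measure; rewrite ?inE//.
  by apply: measurableU.
have muS2 : #|K|%:R * T <= (1 + eps) * v.
  rewrite -lee_fin -muV; apply: (@le_trans _ _ (mu U)).
    by apply: le_measure; rewrite ?inE.
  have -> : U = S `|` (U `\` S) by rewrite setDUK.
  apply: (le_trans (measureU2 _ _ _)) => //; first exact: measurableD.
  by rewrite mulrDl mul1r EFinD -muSE leeD2l// ltW.
exists n, K; split => //.
  rewrite -(ler_nat R) -(ler_pM2r T0); apply: le_trans muS1.
  rewrite /T mulrA ler_pdivrMr// [leRHS]mulrC -ler_pdivrMr//; lra.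
move=> j s jK; rewrite /= in_itv/= => /andP[s0 s1] Ss; move/negP: jK; apply.
rewrite inE; apply/asboolP; exists (s + j%:R * T) => //.
by rewrite /cell/= in_itv/= addrC lerDl s0 /= ltrD2l.
Qed.

End Covering.

(** * Extension of spectral data by zero *)

Section PaleyWiener.
Variables (R : realType) (S : set R) (a b : R -> R).
Local Notation mu := (@lebesgue_measure R).
Local Notation I2 := (`[0, 2 * pi[%classic : set R).
Hypothesis mS : measurable S.
Hypothesis S2pi : S `<=` `[0, 2 * pi]%classic.
Hypothesis ma : measurable_fun S a.
Hypothesis mb : measurable_fun S b.

(** S may contain 2 * pi, which the half-open interval misses; the loss is a null set. *)
Lemma integral_restrict_itv (f : R -> R) : measurable_fun S f ->
  (\int[mu]_(t in S) (f t)%:E = \int[mu]_(t in I2) ((f \_ S) t)%:E)%E.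
Proof.
move=> mf.
have mfS : measurable_fun [set: R] (f \_ S) by apply/(measurable_restrictT f mS).
rewrite integral_itv_bndo_bndc; last first.
  by apply/measurable_EFinP; exact: measurable_funTS.
have {1}<- : `[0, 2 * pi]%classic `&` S = S by apply/setIidPr.
rewrite integral_mkcondr; apply: eq_integral => t _.
by rewrite restrict_EFin.
Qed.

Hypothesis ab_fin :
  (\int[mu]_(t in S) ((a t) ^+ 2 + (b t) ^+ 2)%:E < +oo)%E.

Lemma measurable_restrict_setT (f : R -> R) : measurable_fun S f ->
  measurable_fun [set: R] (f \_ S).
Proof. by move=> mf; apply/(measurable_restrictT f mS). Qed.

Lemma sqint_restrict : sqint mu I2 (a \_ S) /\ sqint mu I2 (b \_ S).
Proof.
have mI : @measurable _ (measurableTypeR R) I2 by [].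
have ms : measurable_fun S (fun t => a t ^+ 2 + b t ^+ 2).
  by apply: measurable_funD; exact: measurable_funX.
have ii : mu.-integrable I2 (EFin \o ((fun t => a t ^+ 2 + b t ^+ 2) \_ S)).
  apply/integrableP; split.
    by apply/measurable_EFinP; apply: measurable_funTS; exact: measurable_restrict_setT.
  apply: le_lt_trans ab_fin; rewrite (integral_restrict_itv ms).
  rewrite le_eqVlt; apply/orP; left; apply/eqP; apply: eq_integral.
  move=> t _ /=; rewrite ger0_norm// patchE; case: ifP => // _.
  by rewrite addr_ge0 ?sqr_ge0.
split; split; do ?[by apply: measurable_funTS; exact: measurable_restrict_setT].
- apply: (@le_integrable _ _ _ mu I2 mI _ _ _ _ ii).
    apply/measurable_EFinP; apply: measurable_funX; apply: measurable_funTS.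
    exact: measurable_restrict_setT.
  move=> t _ /=; rewrite lee_fin !patchE; case: ifP => // _; last by rewrite expr0n.
  by rewrite !ger0_norm ?addr_ge0 ?sqr_ge0// lerDl sqr_ge0.
- apply: (@le_integrable _ _ _ mu I2 mI _ _ _ _ ii).
    apply/measurable_EFinP; apply: measurable_funX; apply: measurable_funTS.
    exact: measurable_restrict_setT.
  move=> t _ /=; rewrite lee_fin !patchE; case: ifP => // _; last by rewrite expr0n.
  by rewrite !ger0_norm ?addr_ge0 ?sqr_ge0// lerDr sqr_ge0.
Qed.

Lemma PW_fre x : fine (\int[mu]_(t in S) (a t * cos (x * t) - b t * sin (x * t))%:E) =
  fre (a \_ S) (b \_ S) x.
Proof.
rewrite integral_restrict_itv; last first.
  by apply: measurable_funB; apply: measurable_funM => //;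
    [exact: measurable_cosM|exact: measurable_sinM].
rewrite /fre /Rintegral; congr fine; apply: eq_integral => t _.
by rewrite !patchE; case: ifP => // _; rewrite !mul0r subrr.
Qed.

Lemma PW_fim x : fine (\int[mu]_(t in S) (a t * sin (x * t) + b t * cos (x * t))%:E) =
  fim (a \_ S) (b \_ S) x.
Proof.
rewrite integral_restrict_itv; last first.
  by apply: measurable_funD; apply: measurable_funM => //;
    [exact: measurable_sinM|exact: measurable_cosM].
rewrite /fim /Rintegral; congr fine; apply: eq_integral => t _.
by rewrite !patchE; case: ifP => // _; rewrite !mul0r addr0.
Qed.

End PaleyWiener.

(** * Choice of parameters and conclusion *)

Unset Implicit Arguments.

Theorem theorem1 (R : realType) (d : R) (hd : 0 < d) :
  exists C : R, 0 < C /\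
  forall S : set R,
    compact S -> S `<=` `[0, 2 * pi]%classic ->
    (0 < @lebesgue_measure R S)%E ->
    exists (L : set int) (D : R),
      has_uniform_density L D /\ D < (1 + d) * nmeas S /\
      forall fr fi : R -> R, PW S fr fi ->
        ((C * nmeas S)%:E * L2norm2 fr fi <=
         \esum_(l in L) ((fr l%:~R) ^+ 2 + (fi l%:~R) ^+ 2)%:E)%E.
Proof.
have [d1 [d10 d1d]] : exists d1 : R, 0 < d1 /\ (1 + 2 * d1) * (1 + d1) < 1 + d.
  (* With m = min(d, 1) the product is 1 + 3 m / 8 + m^2 / 32, below 1 + m because m <= 1. One
     factor pays for the cover of S, the other for the row count and its rounding. *)
  exists (Num.min d 1 / 8); have m0 : 0 < Num.min d 1 by rewrite lt_min hd ltr01.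
  have md : Num.min d 1 <= d by rewrite ge_min lexx.
  have m1 : Num.min d 1 <= 1 by rewrite ge_min lexx orbT.
  split; first by rewrite divr_gt0.
  have : Num.min d 1 * Num.min d 1 <= Num.min d 1 * 1 by rewrite ler_pM2l.
  lra.
have [C [C0 HC]] := fourier_rows_selection d10.
exists C; split => // S cS S2pi S0.
have mS : measurable S by exact: compact_measurable.
(* With more than 1 / d1 cells, rounding (1 + d1) * #|K| up to an integer costs at most d1 *
   #|K|. *)
have [n [K [n0 NK lo hi supp]]] :=
  grid_cover cS S2pi S0 (Num.truncn d1^-1).+1 d10.
set v := fine _ in lo hi.
have nR : 0 < n%:R :> R by rewrite ltr0n.
have p0 : 0 < 2 * pi :> R by rewrite mulr_gt0// pi_gt0.
have K0 : (0 < #|K|)%N by exact: leq_trans NK.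
have v0 : 0 < v.
  apply: fine_gt0; rewrite S0/=; exact: compact_finite_measure.
have dK : 1 <= d1 * #|K|%:R.
  rewrite mulrC -ler_pdivrMr// mul1r; apply: (@le_trans _ _ (Num.truncn d1^-1).+1%:R).
    by apply: ltW; exact: truncnS_gt.
  by rewrite ler_nat.
pose k := (Num.truncn ((1 + d1) * #|K|%:R)).+1.
have k0 : 0 <= (1 + d1) * #|K|%:R by rewrite mulr_ge0//; lra.
have /andP[t1 t2] := truncn_itv k0.
have k1 : (1 + d1) * #|K|%:R <= k%:R by exact: ltW.
have k2 : k%:R <= (1 + 2 * d1) * #|K|%:R by rewrite /k -natr1; lra.
have k3 : k%:R <= 2 * (1 + d1) * #|K|%:R.
  by have : 0 <= #|K|%:R :> R by []; lra.
have [|J [Jk HJ]] := HC n K k K0; first by rewrite k1 k3.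
exists (sample_set J), (#|J|%:R / n%:R); split; first exact: sample_set_uniform_density.
have nmE : nmeas S = v / (2 * pi) by [].
split.
  rewrite nmE ltr_pdivrMr//.
  have j1 : #|J|%:R <= (1 + 2 * d1) * #|K|%:R :> R.
    by apply: le_trans k2; rewrite ler_nat.
  have j2 : #|K|%:R <= (1 + d1) * v / (2 * pi) * n%:R.
    move: hi; rewrite mulrA ler_pdivrMr// => hi.
    by rewrite mulrAC ler_pdivlMr.
  apply: (le_lt_trans j1).
  apply: (@le_lt_trans _ _ ((1 + 2 * d1) * ((1 + d1) * v / (2 * pi) * n%:R))).
    by rewrite ler_pM2l//; lra.
  rewrite mulrA ltr_pM2r// mulrA [ltRHS]mulrA ltr_pM2r ?invr_gt0// mulrA.
  by rewrite ltr_pM2r.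
move=> fr fi [a [b [ma mb abfin frE fiE]]].
have [sa sb] := sqint_restrict mS S2pi ma mb abfin.
have frE' x : fr x = fre (a \_ S) (b \_ S) x by rewrite frE PW_fre.
have fiE' x : fi x = fim (a \_ S) (b \_ S) x by rewrite fiE PW_fim.
have suppR (j : 'I_n) s : j \notin K -> `[0, 2 * pi / n%:R[%classic s ->
    (a \_ S) (s + j%:R * (2 * pi / n%:R)) = 0 /\
    (b \_ S) (s + j%:R * (2 * pi / n%:R)) = 0.
  move=> jK sI; have nS := supp j s jK sI.
  by rewrite !patchE memNset.
have low := sampling_lower_bound n0 (measurable_restrict_setT mS ma)
  (measurable_restrict_setT mS mb) sa sb suppR HJ.
have up := fourier_integral_norm_le sa sb.
set P := ip _ _ _ _ + ip _ _ _ _ in low up.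
have P0 : 0 <= P by rewrite addr_ge0// ip_ge0.
have nm0 : 0 <= C * nmeas S by rewrite nmE mulr_ge0 ?(ltW C0)// divr_ge0 ?ltW.
have -> : L2norm2 fr fi = (\int[lebesgue_measure]_(x in [set: R])
   (fre (a \_ S) (b \_ S) x ^+ 2 + fim (a \_ S) (b \_ S) x ^+ 2)%:E)%E.
  by apply: eq_integral => x _; rewrite frE' fiE'.
have -> : (\esum_(l in sample_set J) (fr l%:~R ^+ 2 + fi l%:~R ^+ 2)%:E)%E =
   (\esum_(l in sample_set J) (fre (a \_ S) (b \_ S) l%:~R ^+ 2 +
      fim (a \_ S) (b \_ S) l%:~R ^+ 2)%:E)%E.
  by apply: eq_esum => l _; rewrite frE' fiE'.
apply: le_trans low.
(* The 2 * pi of the norm bound cancels the one in [nmeas], and v <= #|K| * (2 * pi / n)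
   finishes. *)
apply: (@le_trans _ _ ((C * nmeas S)%:E * (2 * pi * P)%:E)%E).
  by rewrite lee_wpmul2l ?lee_fin.
rewrite -EFinM lee_fin nmE.
have gen (q : R) : q != 0 -> C * (v / q) * (q * P) = C * v * P by move=> q0; field.
rewrite gen ?gt_eqF//.
by rewrite ler_wpM2r// -mulrA ler_pM2l.
Qed.
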